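(* Let $d,Q\in\mathbb N$ with $Q\ge 2$, and let $\varphi:\mathbb T\to\mathbb R^d$ be a centered rational step function with denominator $Q$ and values $\Phi:\mathbb Z_Q\to\mathbb R^d$. Then there is a collection $\mathrm{SBAD}\subset\mathbb R\setminus\mathbb Q$ of full Lebesgue measure such that $\mathrm{SBAD}\supset\mathrm{BAD}$ and such that, if $\alpha\in\mathrm{SBAD}$, then $(\mathbb T\times\Gamma,\mathcal B(\mathbb T\times\Gamma),m_{\mathbb T}\times m_\Gamma,T_{\alpha,\varphi})$ is a conservative, ergodic, measure preserving transformation, where $\Gamma:=\overline{\langle\varphi(\mathbb T)\rangle}$ is the closed subgroup of $\mathbb R^d$ generated by $\Phi(\mathbb Z_Q)$.
   Context: $\mathbb T:=\mathbb R/\mathbb Z\cong[0,1)$. $\mathbb Z_Q=\mathbb Z/Q\mathbb Z$ is identified with $\{0,1,\dots,Q-1\}$. The rational step function with denominator $Q$ and values $\Phi:\mathbb Z_Q\to\mathbb R^d$ is $\varphi:\mathbb T\to\mathbb R^d$, $\varphi(x):=\Phi(\lfloor Qx\rfloor)$ for $x\in[0,1)$. It is centered if $\int_{\mathbb T}\varphi(x)\,dx=0$, equivalently $\sum_{k\in\mathbb Z_Q}\Phi(k)=0$. The skew product is $T_{\alpha,\varphi}(x,y):=(x+\alpha,y+\varphi(x))$; it preserves $\mathbb T\times\Gamma$ and $m_{\mathbb T}\times m_\Gamma$. Here $m_{G}$ denotes Haar measure on the locally compact, Polish, Abelian group $G$ (normalized if $G$ is compact), and $\mathcal B$ denotes Borel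 sets. The set of badly approximable irrationals is $\mathrm{BAD}:=\{\alpha\in\mathbb R\setminus\mathbb Q:\ \exists\,\theta>0,\ |\alpha-\tfrac pq|\ge\tfrac{\theta}{q^2}\text{ for all } p\in\mathbb Z,\ q\in\mathbb N\}$. *)

(* Defs.v *)
From HB Require Import structures.
From mathcomp Require Import all_boot all_order all_algebra.
From mathcomp Require Import all_classical all_reals all_analysis.

Set Implicit Arguments.
Unset Strict Implicit.
Unset Printing Implicit Defensive.

Import Order.TTheory GRing.Theory Num.Theory.
Import numFieldNormedType.Exports.

Local Open Scope classical_set_scope.
Local Open Scope ring_scope.

(* [borel X * borel Y] carries the product sigma-algebra, which is the Borel
   sigma-algebra of [X * Y] when [X] and [Y] are second countable. *)
Notation borel X := (g_sigma_algebraType (@open X)).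

Section ergodic_theory.
Context d (X : measurableType d) (R : realType).
Variables (mu : set X -> \bar R) (T : X -> X).

Definition measure_preserving :=
  measurable_fun setT T /\
  forall A, measurable A -> mu (T @^-1` A) = mu A.

Definition wandering (W : set X) :=
  trivIset [set: nat] (fun n => iter n T @^-1` W).

Definition conservative :=
  forall W, measurable W -> wandering W -> mu W = 0%E.

(* Invariance is only required modulo null sets. *)
Definition ergodic :=
  forall A, measurable A ->
    mu ((T @^-1` A `\` A) `|` (A `\` T @^-1` A)) = 0%E ->
    mu A = 0%E \/ mu (~` A) = 0%E.

End ergodic_theory.

(* Regularity is not listed: it is automatic for Borel measures that are finite
   on compact sets when [G] is locally compact and Polish. *)
Definition haar_measure (R : realType) (G : PreTopologicalZmodule.type)
    (mu : set G -> \bar R) :=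
  [/\ forall (g : G) (A : set G), <<s @open G >> A ->
        mu [set x | A (g + x)] = mu A,
      forall K : set G, compact K -> (mu K < +oo)%E,
      (0 < mu setT)%E &
      compact [set: G] -> mu setT = 1%E].

Section circle.
Variable R : realType.

Local Notation R_mod_Z :=
  (Quotient.quot (GRing.ZmodClosed.clone R (@Num.int_num_subdef R) _)).

Definition circle : Type := quotient_topology R_mod_Z.

HB.instance Definition _ := PointedTopological.on circle.
HB.instance Definition _ := Quotient.on circle.
HB.instance Definition _ := GRing.Zmodule.copy circle R_mod_Z.

Definition to_circle (a : R) : circle := \pi_(circle)%qT a.

(* The representative in [0, 1) of a point of the circle; [repr] is an
   unspecified representative. *)
Definition circle_frac (x : circle) : R := repr x - (Num.floor (repr x))%:~R.

Lemma circle_fracP (a : R) : circle_frac (to_circle a) = a - (Num.floor a)%:~R.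
Proof.
rewrite /circle_frac; set b := repr _.
have : \pi_(R_mod_Z)%qT b = \pi_(R_mod_Z)%qT a by exact: reprK.
move/eqP; rewrite -Quotient.idealrBE => /intrP[m bam].
have -> : b = a + m%:~R by rewrite -bam addrC subrK.
by rewrite floorDrz ?intr_int// intrKfloor intrD opprD addrACA subrr addr0.
Qed.

Lemma measurable_to_circle :
  measurable_fun setT (to_circle : R -> borel circle).
Proof.
apply: (@measurability _ _ _ (borel circle) _ _ (@open circle)) => //.
move=> _ [U oU <-]; rewrite setTI;
  apply: measurable_realfun.open_measurable.
exact: oU.
Qed.

(* Lebesgue measure on [0, 1), i.e. the normalized Haar measure of R / Z. *)
Definition circle_measure : set (borel circle) -> \bar R :=
  pushforward (mrestr (@lebesgue_measure R) (measurable_itv `[0, 1[))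
    (to_circle : R -> borel circle).

HB.instance Definition _ := Measure.copy circle_measure
  (measure_function_pushforward__canonical__measure_function_Measure
    (mrestr (@lebesgue_measure R) (measurable_itv `[0, 1[))
    measurable_to_circle).

End circle.

Section closed_subgroup.
Context (R : realType) (V : normedModType R).

Definition subgroup_gen (S : set V) : set V :=
  smallest [set H | zmod_closed [in H]] S.

Definition closed_subgroup (S : set V) : Type := closure (subgroup_gen S).

Variable S : set V.

Lemma closure_subgroup_gen_zmod_closed :
  zmod_closed [in closure (subgroup_gen S)].
Proof.
have sg0 : subgroup_gen S 0 by move=> H [[/set_mem]].
have sgB x y : subgroup_gen S x -> subgroup_gen S y -> subgroup_gen S (x - y).
  move=> Sx Sy H [[H0 HB] SH]; apply/set_mem/HB; apply/mem_set.
  - exact: Sx.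
  - exact: Sy.
split; first by apply/mem_set; exact: subset_closure.
move=> x y /set_mem clx /set_mem cly; apply/mem_set => B.
move=> /(@sub_continuous V (x, y))[[B1 B2] /= [nB1 nB2] B12].
have [u [Su B1u]] := clx _ nB1; have [v [Sv B2v]] := cly _ nB2.
by exists (u - v); split; [exact: sgB|exact: (B12 (u, v))].
Qed.

HB.instance Definition _ := SubChoice.on (closed_subgroup S).
HB.instance Definition _ := Topological.on (closed_subgroup S).
HB.instance Definition _ := GRing.SubChoice_isSubZmodule.Build V _
  (closed_subgroup S) closure_subgroup_gen_zmod_closed.
HB.instance Definition _ := isPointed.Build (closed_subgroup S) 0.

Lemma closed_subgroup_gen (v : V) :
  S v -> v \in closure (subgroup_gen S).
Proof.
by move=> Sv; apply/mem_set/subset_closure => H [_]; exact.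
Qed.

End closed_subgroup.

(* [f] with codomain restricted to the closed subgroup generated by its range *)
Definition corestrict (R : realType) (V : normedModType R) (X : Type)
    (f : X -> V) (x : X) : closed_subgroup (range f) :=
  exist _ (f x) (closed_subgroup_gen (imageT f x)).

(* The integer [floor (Q x)] lies in {0, ..., Q - 1}; its cast to ['Z_Q] is
   meaningful for [1 < Q]. *)
Definition step_function (R : realType) (V : Type) (Q : nat) (Phi : 'Z_Q -> V)
    (x : circle R) : V :=
  Phi (Num.floor (Q%:R * circle_frac x))%:~R.

Definition centered (R : realType) (d : nat) (phi : circle R -> 'rV[R]_d) :=
  forall i : 'I_d, (\int[@circle_measure R]_x (phi x 0 i)%:E = 0)%E.

Definition skew_product (R : realType) (G : zmodType) (alpha : R)
    (f : circle R -> G) (z : circle R * G) : circle R * G :=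
  (z.1 + to_circle alpha, z.2 + f z.1).

Definition badly_approximable (R : realType) : set R :=
  [set alpha | irrational alpha /\
    exists2 theta : R, 0 < theta &
      forall (p : int) (q : nat), (0 < q)%N ->
        theta / q%:R ^+ 2 <= `|alpha - p%:~R / q%:R| ].

(* Main.v *)
Require Import Defs.
From HB Require Import structures.
From mathcomp Require Import all_boot all_order all_algebra.
From mathcomp Require Import all_classical all_reals all_analysis.
From mathcomp Require Import measurable_realfun.
From mathcomp Require Import zify lra.

Set Implicit Arguments.
Unset Strict Implicit.
Unset Printing Implicit Defensive.

Import Order.TTheory GRing.Theory Num.Theory.
Import numFieldNormedType.Exports.

Local Open Scope classical_set_scope.
Local Open Scope ring_scope.

(** The step function is treated through its lift to the free abelian group
    on the cells [k / Q, (k + 1) / Q): the Birkhoff sum of order [q] at [x] is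
    the vector [birkhoff Q alpha q x] that counts the visits of the orbit to
    each cell, and the sum of [phi] is its image under [combination]. Since
    [phi] is centered, [combination] kills the constant vectors.

    The set [SBAD] is chosen so that [alpha] has arbitrarily large denominators
    [q] that are good: [q alpha] is within [1 / q] of an integer [p] coprime to
    [q], while no multiple [j alpha] with [0 < j <= Q q] comes closer than
    [c / q] to an integer ([SBAD_good_denominator]). For badly approximable
    [alpha] every scale is admissible; for almost every [alpha] infinitely many
    scales are, because at each single scale the exceptional set has measure
    [O(c)] per unit interval ([SBAD_conegligible_unit]). Two facts hold along a
    good denominator.
    - As in the Denjoy-Koksma inequality, the entries of [birkhoff Q alpha q x]
      differ by at most [3 Q] ([birkhoff_spread]), so modulo constant vectors
      the sum takes finitely many values, independently of [q].
    - The discontinuities of [birkhoff Q alpha q] are [c / (Q q)]-separated,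
      and within [2 / q] of any [x] there is one at which the sum jumps from
      [w + e_(k-1)] to [w + e_k] ([birkhoff_jump]).

    Conservativity follows from the first fact: at times [q] the preimages of a
    set of bounded height remain in one set of finite measure, which has no room
    for infinitely many disjoint sets of equal positive measure ([wandering_null]).

    For ergodicity let [A] be invariant modulo null sets, [B] a box in [Gamma],
    and let [g v x] be the measure of those [y] in the section of [A] above [x]
    for which [y + combination v] lies in [B]. Invariance reads
    [g v (x + alpha) = g (v + e_k) x] with [k] the cell of [x]. Take a common
    Lebesgue point [x] of the [g v], and compare [g v] with its translate by
    [q alpha], which is close to [0] modulo 1, on the two intervals beside the
    jump: they fill a fixed proportion of a ball around [x], so the limit along [q]
    shows that [g] is unchanged at [x] when [v] moves by [d] and by
    [d - e_k + e_(k-1)] for some vector [d]. Hence all [e_k] act alike on [g]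
    ([equivariant_jump]); [Q] steps of the rotation then add a constant vector,
    which does nothing, so each [g v] is invariant under the irrational rotation
    by [Q alpha] and is constant; finally the constant does not depend on [v]
    ([equivariant_constant]).

    Therefore the measure [B |-> mu (A & (circle x B))] is invariant under the
    group generated by the values of [phi]; by density it is invariant under
    [Gamma], hence equal to [lam * m] by uniqueness of Haar measure
    ([dense_translation_invariant], [invariant_measures_proportional]). As the
    sections of [A] have almost everywhere the same measure inside a given box,
    [mu (A & E) = lam * mu E] holds for rectangles [E] over boxes, and so for all
    [E] ([product_measure_boxes_unique]). For [E] the complement of [A] this forces
    [lam = 0] or [mu (~` A) = 0], and [lam = 0] gives [mu A = 0] on taking [E]
    equal to [A]. *)

(** * Diophantine approximation and the set SBAD *)

(** The fractional parts of [j alpha] for [0 <= j <= N] fall into [N] intervals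
    of length [1 / N], so two of them share an interval. *)
Lemma dirichlet (R : realType) (alpha : R) (N : nat) : (0 < N)%N ->
  exists q p, [/\ (0 < q)%N, (q <= N)%N & N%:R * `|q%:R * alpha - p%:~R| < 1].
Proof.
move=> N0.
pose fr (j : nat) : R := j%:R * alpha - (Num.floor (j%:R * alpha))%:~R.
have fr0 j : 0 <= fr j by rewrite subr_ge0 floor_le.
have fr1 j : fr j < 1 by rewrite ltrBlDl; have := floorD1_gt (j%:R * alpha); rewrite intrD.
have NR : 0 < N%:R :> R by rewrite ltr0n.
have bxP (j : 'I_N.+1) : (`|Num.floor (N%:R * fr j)| < N)%N.
  have h0 : 0 <= Num.floor (N%:R * fr j) by rewrite floor_ge0 mulr_ge0// ltW.
  rewrite -ltz_nat gez0_abs// floor_lt_int//.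
  by rewrite -[ltRHS]mulr1 ltr_pM2l.
pose bx (j : 'I_N.+1) : 'I_N := Ordinal (bxP j).
have : ~~ injectiveb bx.
  apply/negP => /injectiveP/leq_card; rewrite !card_ord => ?; lia.
case/injectivePn => j1 [j2 j12 bE].
wlog lt12 : j1 j2 j12 bE / (j1 < j2)%N.
  move=> W; have [|h|h] := ltngtP j1 j2; first exact: W.
    by apply: (W j2 j1) => //; rewrite eq_sym.
  by move/eqP: j12; case; apply: val_inj.
have fE : Num.floor (N%:R * fr j1) = Num.floor (N%:R * fr j2).
  have h0 (j : 'I_N.+1) : 0 <= Num.floor (N%:R * fr j).
    by rewrite floor_ge0 mulr_ge0// ltW.
  by have [] := congr1 val bE => /= e; rewrite -(gez0_abs (h0 j1)) e gez0_abs.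
exists (j2 - j1)%N, (Num.floor (j2%:R * alpha) - Num.floor (j1%:R * alpha)).
split; [by rewrite subn_gt0| have := ltn_ord j2; lia|].
rewrite natrB 1?ltnW// intrB.
have -> : (j2%:R - j1%:R) * alpha - ((Num.floor (j2%:R * alpha))%:~R - (Num.floor (j1%:R * alpha))%:~R)
  = fr j2 - fr j1 by rewrite /fr; lra.
rewrite -[N%:R]ger0_norm ?ltW// -normrM mulrBr.
have := floor_le (N%:R * fr j1); have := floorD1_gt (N%:R * fr j1).
have := floor_le (N%:R * fr j2); have := floorD1_gt (N%:R * fr j2).
rewrite fE !intrD; move: (Num.floor _)%:~R => f h1 h2 h3 h4.
rewrite ltr_norml; apply/andP; split; lra.
Qed.

(** Dividing [p] and [q] by their gcd only improves the approximation. *)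
Lemma dirichlet_coprime (R : realType) (alpha : R) (N : nat) : (0 < N)%N ->
  exists q p, [/\ (0 < q)%N, (q <= N)%N, coprimez p q &
    N%:R * `|q%:R * alpha - p%:~R| < 1].
Proof.
move=> N0; have [q [p [q0 qN h]]] := dirichlet alpha N0.
pose g := gcdn `|p| q.
have g0 : (0 < g)%N by rewrite gcdn_gt0 q0 orbT.
have qE : q = (g * (q %/ g))%N by rewrite mulnC divnK// dvdn_gcdr.
have pE : p = g%:Z * (p %/ g%:Z)%Z by rewrite mulrC divzK//; apply: dvdn_gcdl.
have q'0 : (0 < q %/ g)%N by rewrite divn_gt0// dvdn_leq// dvdn_gcdr.
exists (q %/ g)%N, (p %/ g%:Z)%Z; split => //.
- by rewrite (leq_trans _ qN)// leq_div.
- rewrite /coprimez /gcdz eqz_nat /=.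
  have : g = (g * gcdn `|(p %/ g%:Z)%Z| (q %/ g))%N.
    by rewrite muln_gcdr -qE [in LHS]/g; congr gcdn; rewrite {1}pE abszM.
  by move/eqP; rewrite -{1}(muln1 g) eqn_pmul2l// eq_sym.
- apply: le_lt_trans h; apply: ler_wpM2l => //.
  rewrite [in leRHS]qE [in leRHS]pE natrM intrM -mulrA -mulrBr normrM.
  by rewrite ler_peMl// ger0_norm// ler1n.
Qed.

(** At the scale [N] the multiples of [alpha] up to [Q N] stay [c / N] away from
    the integers; the second clause makes the first [c N] of them stay even
    [1 / N] away, so that the denominator which Dirichlet's theorem provides at
    this scale exceeds [c N]. *)
Definition well_separated (R : realType) (Q : nat) (alpha c : R) (N : nat) :=
  forall (j : nat) (p : int), (0 < j <= Q * N)%N ->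
    c <= N%:R * `|j%:R * alpha - p%:~R| /\
    (j%:R <= c * N%:R -> 1 <= N%:R * `|j%:R * alpha - p%:~R|).

Definition SBAD (R : realType) (Q : nat) : set R :=
  [set alpha | exists2 c : R, 0 < c &
    forall N0, exists2 N, (N0 <= N)%N & well_separated Q alpha c N].
Arguments SBAD : clear implicits.

Lemma SBAD_irrational (R : realType) (Q : nat) : (0 < Q)%N ->
  SBAD R Q `<=` @irrational R.
Proof.
move=> Q0 alpha [c c0 H] /rationalP[a [b alphaE]].
wlog b0 : a b alphaE / (0 < b)%N.
  move=> W; case: b alphaE => [E|b E]; last exact: (W a b.+1).
  by apply: (W 0 1%N) => //; rewrite E invr0 mulr0 mul0r.
have [N bN /(_ b a)] := H b.
have /[swap]/[apply] -[] : (0 < b <= Q * N)%N.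
  by rewrite b0 (leq_trans bN)// leq_pmull.
rewrite alphaE [b%:R * _]mulrC divfK ?pnatr_eq0 -?lt0n// subrr normr0 mulr0.
by rewrite leNgt c0.
Qed.

Lemma badly_approximable_SBAD (R : realType) (Q : nat) : (0 < Q)%N ->
  @badly_approximable R `<=` SBAD R Q.
Proof.
move=> Q0 alpha [_ [theta th0 H]].
have QR : 0 < Q%:R :> R by rewrite ltr0n.
exists (theta / Q%:R); first by rewrite divr_gt0.
move=> N0; exists N0.+1 => // j p /andP[j0 jQ].
have jR : 0 < j%:R :> R by rewrite ltr0n.
have {}H : theta / j%:R <= `|j%:R * alpha - p%:~R|.
  have -> : j%:R * alpha - p%:~R = j%:R * (alpha - p%:~R / j%:R).
    by rewrite mulrBr mulrCA divff ?mulr1// gt_eqF.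
  rewrite normrM ger0_norm// -ler_pdivrMl// -[leLHS]mulrC -mulrA -invfM -expr2.
  exact: H.
have NR : 0 < N0.+1%:R :> R by rewrite ltr0n.
have {}jQ : j%:R <= Q%:R * N0.+1%:R :> R by rewrite -natrM ler_nat.
split.
  rewrite -ler_pdivrMl//; apply: le_trans H.
  rewrite mulrC -mulrA -invfM; apply: ler_wpM2l; first exact: ltW.
  by rewrite lef_pV2// posrE mulr_gt0.
move=> h; rewrite -ler_pdivrMl//; apply: le_trans H.
rewrite mulr1 ler_pdivlMr// ler_pdivrMl//  mulrC (le_trans h)//.
apply: ler_wpM2r; first exact: ltW.
by rewrite ler_pdivrMr// ler_peMr ?ler1n// ltW.
Qed.

Definition good_denominator (R : realType) (Q : nat) (alpha c : R)
    (q : nat) (p : int) :=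
  [/\ (0 < q)%N, coprimez p q, q%:R * `|q%:R * alpha - p%:~R| <= 1 &
    forall (j : nat) (p' : int), (0 < j <= Q * q)%N ->
      c <= q%:R * `|j%:R * alpha - p'%:~R|].

(** Dirichlet's theorem at a well separated scale [N] gives a denominator
    [q <= N], and separation of the small multiples forces [q > c N]. As [q] and
    [N] are comparable, separation at scale [N] is separation at scale [q], with
    [c ^ 2] instead of [c]. *)
Lemma SBAD_good_denominator (R : realType) (Q : nat) (alpha : R) : (0 < Q)%N ->
  SBAD R Q alpha ->
  exists2 c, 0 < c & forall q0, exists2 q, (q0 <= q)%N &
     exists p, good_denominator Q alpha c q p.
Proof.
move=> Q0 [c c0 H]; exists (c * c); first by rewrite mulr_gt0.
move=> q0; pose N0 := (Num.truncn (q0%:R / c)).+1.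
have [N N0N HN] := H N0.
have N0' : (0 < N)%N by rewrite (leq_trans _ N0N).
have [q [p [q0' qN pq small]]] := dirichlet_coprime alpha N0'.
have NR : 0 < N%:R :> R by rewrite ltr0n.
have qR : 0 < q%:R :> R by rewrite ltr0n.
have cNq : c * N%:R < q%:R.
  rewrite ltNge; apply/negP => h.
  have [] := HN q p; first by rewrite q0' (leq_trans qN)// leq_pmull.
  by move=> _ /(_ h); rewrite leNgt small.
exists q.
  rewrite -(@ler_nat R) ltW// (le_lt_trans _ cNq)// mulrC -ler_pdivrMr//.
  by rewrite ltW// (lt_le_trans (truncnS_gt _))// ler_nat.
exists p; split => //.
  by rewrite ltW// (le_lt_trans _ small)// ler_wpM2r// ler_nat.
move=> j p' /andP[j0 jQ]; have [|h _] := HN j p'.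
  by rewrite j0 (leq_trans jQ)// leq_mul2l qN orbT.
rewrite (le_trans (ler_wpM2l (ltW c0) h))// mulrA ler_wpM2r//; exact: ltW.
Qed.

Lemma measure_eventually_le d (T : measurableType d) (R : realType)
    (mu : {measure set T -> \bar R}) (B : nat -> set T) (e : \bar R) :
  (forall n, measurable (B n)) -> (forall n, (mu (B n) <= e)%E) ->
  measurable (\bigcup_n \bigcap_(m in [set m | (n <= m)%N]) B m) /\
  (mu (\bigcup_n \bigcap_(m in [set m | (n <= m)%N]) B m) <= e)%E.
Proof.
move=> mB muB; set F := fun n => \bigcap_(m in _) B m.
have mF n : measurable (F n) by exact: bigcap_measurableType.
split; first exact: bigcupT_measurable.
have ndF : nondecreasing_seq F.
  move=> n1 n2 n12; apply/subsetPset => x Fx m /= n2m.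
  by apply: Fx => /=; exact: leq_trans n2m.
have cv := nondecreasing_cvg_mu (mu := mu) mF (bigcupT_measurable _ mF) ndF.
rewrite -(cvg_lim _ cv)//; apply: lime_le; first by apply/cvg_ex; eexists; exact: cv.
apply/nearW => n; rewrite (le_trans _ (muB n))// le_measure ?inE//.
by move=> x; apply => /=.
Qed.

Lemma sum_leq_ler (R : realType) (x : R) (n : nat) : 0 <= x ->
  \sum_(j < n) (j.+1%:R <= x)%R%:R <= x.
Proof.
move=> x0; elim: n => [|n IH]; first by rewrite big_ord0.
case: (leP n.+1%:R x) => h; last first.
  by rewrite big_ord_recr/= (_ : (n.+1%:R <= x) = false) ?addr0//; apply/negbTE; rewrite -ltNge.
apply: le_trans h; rewrite [leRHS](_ : _ = \sum_(j < n.+1) 1); last by rewrite sumr_const card_ord.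
by apply: ler_sum => i _; case: (_ <= x); rewrite /= ?lexx ?ler01.
Qed.

Lemma measure_bigsetU_le d (T : measurableType d) (R : realType)
    (mu : {measure set T -> \bar R}) (F : nat -> set T) (n : nat) :
  (forall k, measurable (F k)) ->
  (mu (\big[setU/set0]_(k < n) F k) <= \sum_(k < n) mu (F k))%E.
Proof.
by move=> mF; apply: content_subadditive => //; exact: bigsetU_measurable.
Qed.

(** Fix [c]. The points of [[n, n + 1)] for which the scale [N] is not well
    separated are covered by the balls of radius [tau / (N j)] around the
    fractions with denominator [j <= Q N], where [tau = 1] for [j <= c N] and
    [tau = c] otherwise. About [j] fractions meet the interval for each [j], so
    the total measure is [O (sum_j tau / N) = O (c (Q + 1))]. A point outside
    [SBAD] fails at all large scales for every [c], and [c] is arbitrary. *)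
Lemma SBAD_conegligible_unit (R : realType) (Q : nat) (n : int) : (0 < Q)%N ->
  (@lebesgue_measure R).-negligible
    (~` SBAD R Q `&` [set x | n%:~R <= x < n%:~R + 1]).
Proof.
move=> Q0.
pose tau (c : R) (N j : nat) : R := if j%:R <= c * N%:R then 1 else c.
pose Bl (c : R) N j i : set R :=
  ball ((n%:~R * j.+1%:R + i%:R - 1) / j.+1%:R : R) (tau c N j.+1 / (N%:R * j.+1%:R)).
(* The numerators [n * j - 1, ..., n * j + j + 1] include all those whose ball, of
   radius at most [1 / j], meets [[n, n + 1)]. *)
pose Bj (c : R) N j : set R := \big[setU/set0]_(i < (j.+1 + 3)%N) Bl c N j i.
have mBj c N j : measurable (Bj c N j).
  by apply: bigsetU_measurable => i _; exact: measurable_ball.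
pose B c N : set R := \big[setU/set0]_(j < (Q * N)) Bj c N j.
have mB c N : measurable (B c N).
  exact: bigsetU_measurable.
have muB (c : R) (N : nat) : 0 < c -> (lebesgue_measure (B c N.+1) <= (8 * c * (Q%:R + 1))%:E)%E.
  move=> c0.
  have tau0 (j : nat) : 0 <= tau c N.+1 j by rewrite /tau; case: ifP => // _; exact: ltW.
  apply: (@le_trans _ _ (\sum_(j < (Q * N.+1)) (8 * tau c N.+1 j.+1 / N.+1%:R)%:E)%E).
    apply: (le_trans (measure_bigsetU_le (@lebesgue_measure R) _ (mBj c N.+1))).
    apply: lee_sum => -[j /= _] _.
    apply: (le_trans (@measure_bigsetU_le _ _ R (@lebesgue_measure R) (Bl c N.+1 j) _ _)) => [i|].
      exact: measurable_ball.
    rewrite (eq_bigr (fun=> (tau c N.+1 j.+1 / (N.+1%:R * j.+1%:R) *+ 2)%:E)); last first.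
      by move=> i _; apply: lebesgue_measure_ball; rewrite divr_ge0// mulr_ge0.
    rewrite sumEFin lee_fin sumr_const card_ord -mulrnA.
    have -> : tau c N.+1 j.+1 / (N.+1%:R * j.+1%:R) = tau c N.+1 j.+1 / N.+1%:R / j.+1%:R.
      by rewrite invfM mulrA.
    rewrite -[_ *+ (2 * _)]mulr_natr mulrAC ler_pdivrMr ?ltr0n// -[8 * _ / _]mulrA.
    have T0 : 0 <= tau c N.+1 j.+1 / N.+1%:R by rewrite divr_ge0.
    have J1 : 1 <= j.+1%:R :> R by rewrite ler1n.
    rewrite natrM natrD; move: (tau c _ _ / _) T0 (j.+1%:R) J1 => T T0 J J1.
    have : 0 <= T * (J - 1) by rewrite mulr_ge0// subr_ge0.
    rewrite mulrBr mulr1; lra.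
  rewrite sumEFin lee_fin.
  have NR : 0 < N.+1%:R :> R by rewrite ltr0n.
  rewrite -mulr_suml ler_pdivrMr// -mulr_sumr -!mulrA ler_pM2l//.
  apply: (@le_trans _ _ (\sum_(j < Q * N.+1) (c + (j.+1%:R <= c * N.+1%:R)%R%:R))).
    apply: ler_sum => j _; rewrite /tau; case: ifP => _ //=; last by rewrite addr0.
    by rewrite lerDr ltW.
  rewrite big_split/= sumr_const card_ord mulrDl mulrDr mul1r.
  apply: lerD; first by rewrite -natrM mulr_natr.
  by apply: sum_leq_ler; rewrite mulr_ge0// ltW.
have sub c : 0 < c <= 1 -> ~` SBAD R Q `&` [set x | n%:~R <= x < n%:~R + 1] `<=`
   \bigcup_N0 \bigcap_(N in [set m | (N0 <= m)%N]) B c N.+1.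
  move=> /andP[c0 c1] x [Sx /andP[nx xn]].
  have : ~ (forall N0, exists2 N, (N0 <= N)%N & well_separated Q x c N).
    by move=> H; apply: Sx; exists c.
  move=> /existsNP[N0 HN0]; exists N0 => // N /= N0N.
  have : ~ well_separated Q x c N.+1.
    by move=> H; apply: HN0; exists N.+1 => //; exact: leqW.
  move=> /existsNP[j /existsNP[p /not_implyP[/andP[j0 jN] H]]].
  have {}H : N.+1%:R * `|j%:R * x - p%:~R| < tau c N.+1 j.
    rewrite /tau ltNge; apply/negP; case: ifPn => [h1 h2|/negP h1 h2]; apply: H; split => //.
    exact: le_trans h2.
  have tau1 : tau c N.+1 j <= 1 by rewrite /tau; case: ifP.
  have H1 : `|j%:R * x - p%:~R| < 1.
    apply: lt_le_trans tau1; apply: le_lt_trans H.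
    by rewrite ler_peMl// ler1n.
  have jR : 0 < j%:R :> R by rewrite ltr0n.
  have [p1 p2] : n * j%:Z - 1 < p + 1 /\ p < n * j%:Z + j%:Z + 1.
    move: H1; rewrite ltr_norml => /andP[h1 h2].
    rewrite -!(ltr_int R) !intrD !intrM mulrNz; split.
      have : n%:~R * j%:R <= j%:R * x by rewrite mulrC ler_pM2l.
      by move: h2; rewrite -!pmulrn; lra.
    have : j%:R * x <= j%:R * (n%:~R + 1) by rewrite ler_pM2l// ltW.
    by move: h1; rewrite -!pmulrn; lra.
  pose e : int := p + 1 - n * j%:Z.
  have pE : e = `|e|%N by rewrite gez0_abs// /e; lia.
  rewrite /B -bigcup_mkord; exists j.-1; first by rewrite /= prednK.
  rewrite /Bj -bigcup_mkord; exists `|e|%N; first by rewrite /= prednK// -ltz_nat -pE /e; lia.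
  rewrite /Bl /ball/= prednK// (_ : _ + _ - 1 = p%:~R); last first.
    have /(congr1 (fun z : int => z%:~R : R)) := pE.
    rewrite /e !intrD mulrNz intrM -!pmulrn => h; lra.
  rewrite -(ltr_pM2l jR) -[X in X * `|_|]gtr0_norm// -normrM mulrBr.
  rewrite mulrCA divff ?gt_eqF// mulr1 distrC.
  rewrite invfM [N.+1%:R^-1 * _]mulrC [ltRHS]mulrCA mulVKf ?gt_eqF//.
  by rewrite ltr_pdivlMr ?ltr0n// mulrC.
exists (\bigcap_(k : nat) \bigcup_N0 \bigcap_(N in [set m | (N0 <= m)%N]) B (k.+1%:R^-1) N.+1).
split.
- apply: bigcapT_measurable => k.
  have [] // := @measure_eventually_le _ _ _ (@lebesgue_measure R)
    (fun N => B k.+1%:R^-1 N.+1) _ (fun N => mB _ _) (fun N => muB _ N _).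
- apply/eqP; rewrite eq_le measure_ge0 andbT; apply/lee_addgt0Pr => e e0; rewrite add0e.
  set k := Num.truncn (8 * (Q%:R + 1) / e).
  have k0 : 0 < k.+1%:R^-1 :> R by rewrite invr_gt0.
  have [mL muL] := @measure_eventually_le _ _ _ (@lebesgue_measure R)
    (fun N => B k.+1%:R^-1 N.+1) _ (fun N => mB _ _) (fun N => muB _ N k0).
  apply: (@le_trans _ _ (8 * k.+1%:R^-1 * (Q%:R + 1))%:E).
    apply: le_trans muL; apply: le_measure; rewrite ?inE//.
      apply: bigcapT_measurable => i.
      have [] // := @measure_eventually_le _ _ _ (@lebesgue_measure R)
        (fun N => B i.+1%:R^-1 N.+1) _ (fun N => mB _ _) (fun N => muB _ N _).
    by move=> x /(_ k Logic.I).
  rewrite lee_fin mulrAC ler_pdivrMr ?ltr0n// [leRHS]mulrC -ler_pdivrMr//.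
  exact/ltW/truncnS_gt.
- move=> x Sx k _; apply: sub Sx.
  by rewrite invr_gt0 ltr0n/= invf_le1// ler1n.
Qed.

Lemma SBAD_conegligible (R : realType) (Q : nat) : (0 < Q)%N ->
  (@lebesgue_measure R).-negligible (~` SBAD R Q).
Proof.
move=> Q0.
pose F k := ~` SBAD R Q `&` [set x | pickle (Num.floor x) = k].
apply: (@negligibleS _ _ _ (@lebesgue_measure R) (\bigcup_k F k)).
  by move=> x Sx; exists (pickle (Num.floor x)).
apply: negligible_bigcup => k.
have [[n nk]|nk] := pselect (exists n : int, pickle n = k); last first.
  rewrite (_ : F k = set0); first exact: negligible_set0.
  by rewrite -subset0 => x [_ /= xk]; apply: nk; exists (Num.floor x).
have sub : F k `<=` ~` SBAD R Q `&` [set x | n%:~R <= x < n%:~R + 1].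
  move=> x [Sx /= xk]; split => //=.
  have -> : n = Num.floor x by apply: (pcan_inj pickleK); rewrite nk xk.
  by rewrite floor_le/=; have := floorD1_gt x; rewrite intrD.
have h := SBAD_conegligible_unit R n Q0.
have h2 := @negligibleS _ _ _ (@lebesgue_measure R) _ _ sub h.
exact: h2.
Qed.

(** * Birkhoff sums in the free abelian group on the cells *)

(** The index is an integer cast to [Z / Q], which makes it 1-periodic in [x]. *)
Definition cell (R : realType) (Q : nat) (x : R) : 'Z_Q :=
  (Num.floor (Q%:R * x))%:~R.

Definition basis_vector (Q : nat) (k : 'Z_Q) : {ffun 'Z_Q -> int} :=
  [ffun l => (k == l)%:R].

Definition birkhoff (R : realType) (Q : nat) (alpha : R) (q : nat) (x : R) :
    {ffun 'Z_Q -> int} :=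
  \sum_(j < q) basis_vector (cell Q (x + j%:R * alpha)).

Lemma cellDz (R : realType) (Q : nat) (x : R) (m : int) : (1 < Q)%N ->
  cell Q (x + m%:~R) = cell Q x.
Proof.
move=> Q1; rewrite /cell mulrDr -[Q%:R]/(Q%:Z%:~R) -intrM floorDrz ?intr_int//.
rewrite intrKfloor intrD intrM [X in _ + X * _](_ : _ = 0) ?mul0r ?addr0//.
by rewrite -[RHS](pchar_Zp Q1) pmulrn.
Qed.

Lemma card_integers_itv (R : realType) (T : finType) (J : {set T}) (f : T -> int)
    (a b : R) : a <= b -> {in J &, injective f} ->
  (forall j, j \in J -> a <= (f j)%:~R <= b) -> #|J|%:R <= b - a + 1.
Proof.
move=> ab finj fJ; pose N := Num.truncn (b - a).
pose h j : int := f j - Num.ceil a.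
have ha j : j \in J -> 0 <= h j /\ (`|h j| <= N)%N.
  move=> /fJ /andP[af fb].
  have h0 : 0 <= h j by rewrite subr_ge0 ceil_le_int.
  split => //; rewrite truncn_ge_nat ?subr_ge0//.
  have -> : `|h j|%:R = (h j)%:~R :> R by rewrite pmulrn gez0_abs.
  by rewrite /h intrD mulrNz lerB// ceil_ge.
pose g j : 'I_N.+1 := inord `|h j|.
have ginj : {in J &, injective g}.
  move=> i j iJ jJ /(congr1 val); have [i0 iN] := ha _ iJ; have [j0 jN] := ha _ jJ.
  rewrite /= !inordK// => ij; apply: finj => //.
  have : h i = h j by rewrite -(gez0_abs i0) ij gez0_abs.
  by rewrite /h; lia.
have : (#|J| <= N.+1)%N.
  by rewrite -(card_in_imset ginj) (leq_trans (max_card _))// card_ord.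
rewrite -(ler_nat R) => /le_trans; apply; rewrite -natr1 lerD2r.
by rewrite truncn_le// subr_ge0.
Qed.

Lemma birkhoffE (R : realType) (Q : nat) (alpha : R) (q : nat) (x : R) (k : 'Z_Q) :
  birkhoff Q alpha q x k =
  #|[set j : 'I_q | cell Q (x + j%:R * alpha) == k]%SET|%:Z.
Proof.
rewrite /birkhoff sum_ffunE.
rewrite -sum1dep_card -[RHS]natz natr_sum [RHS]big_mkcond.
by apply: eq_bigr => j _; rewrite ffunE; case: eqP.
Qed.

Lemma sum_birkhoff (R : realType) (Q : nat) (alpha : R) (q : nat) (x : R) :
  \sum_k birkhoff Q alpha q x k = q%:Z.
Proof.
rewrite /birkhoff; under eq_bigr do rewrite sum_ffunE.
rewrite exchange_big/=; under eq_bigr => j _.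
  rewrite (bigD1 (cell Q (x + j%:R * alpha)))//= ffunE eqxx big1 ?addr0; last first.
    by move=> k kj; rewrite ffunE eq_sym (negbTE kj).
  over.
by transitivity (\sum_(j < q) (1 : int)); [exact: eq_bigr|rewrite sumr_const card_ord natz].
Qed.

Lemma cell_bounds (R : realType) (Q : nat) (x : R) (k : 'Z_Q) : (1 < Q)%N ->
  cell Q x = k ->
  (k%:R : R) <= Q%:R * (x - (Num.floor x)%:~R) < k%:R + 1.
Proof.
move=> Q1; rewrite -(cellDz _ (- Num.floor x) Q1) mulrNz /cell.
set y := x - _; have y0 : 0 <= y by rewrite subr_ge0 floor_le.
have y1 : y < 1 by have := floorD1_gt x; rewrite intrD /y; lra.
have QR : 0 < Q%:R :> R by rewrite ltr0n ltnW.
have n0 : 0 <= Num.floor (Q%:R * y) by rewrite floor_ge0 mulr_ge0// ltW.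
case: (Num.floor _) (floor_itv (Q%:R * y)) n0 => // n /andP[n1 n2] _ <-.
have nQ : (n < Q)%N.
  rewrite -(ltr_nat R) (le_lt_trans n1)// -[ltRHS]mulr1 ltr_pM2l//.
rewrite -pmulrn val_Zp_nat// modn_small//.
by move: n1 n2; rewrite intrD -!pmulrn => -> ->.
Qed.

(** Since [q alpha] is nearly [p], the orbit point [x + j alpha] is nearly
    [x + j p / q]. The integers [f j] encode [j p / q] modulo 1; they are distinct
    by coprimality, and those of the visits to one cell lie in an interval of
    length [q / Q + 2]. *)
Lemma birkhoff_le (R : realType) (Q : nat) (alpha c : R) (q : nat) (p : int)
    (x : R) (k : 'Z_Q) : (1 < Q)%N -> good_denominator Q alpha c q p ->
  Q%:Z * birkhoff Q alpha q x k <= q%:Z + 3 * Q%:Z.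
Proof.
move=> Q1 [q0 pq qp _].
have qR : 0 < q%:R :> R by rewrite ltr0n.
have QR : 0 < Q%:R :> R by rewrite ltr0n ltnW.
pose y (j : nat) := x + j%:R * alpha.
pose f (j : 'I_q) : int := j%:Z * p - q%:Z * Num.floor (y j).
rewrite birkhoffE; set J := [set j : 'I_q | _]%SET.
have finj : {in J &, injective f}.
  move=> i j _ _ ij; apply: val_inj.
  have : (q%:Z %| (i%:Z - j%:Z) * p)%Z.
    apply/dvdzP; exists (Num.floor (y i) - Num.floor (y j)).
    by move: ij; rewrite /f; lia.
  rewrite Gauss_dvdzl; last by rewrite coprimez_sym.
  move=> /dvdzP[m]; have := ltn_ord i; have := ltn_ord j => /= iq jq mE.
  have m0 : m = 0.
    have [m1|m1|//] := ltgtP m 0.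
      have : m * q%:Z <= - q%:Z by nia.
      by rewrite -mE; lia.
    have : m * q%:Z >= q%:Z by nia.
    by rewrite -mE; lia.
  by move: mE; rewrite m0 mul0r; lia.
have fJ j : j \in J -> q%:R * (k%:R / Q%:R - x) - 1 <= (f j)%:~R <=
    q%:R * ((k%:R + 1) / Q%:R - x) + 1.
  rewrite inE => /eqP /(cell_bounds Q1) /andP[h1 h2].
  have e1 : `|j%:R * (q%:R * alpha - p%:~R)| <= 1.
    rewrite normrM (le_trans _ qp)// normr_nat ler_wpM2r// ler_nat ltnW//.
  have -> : (f j)%:~R = q%:R * (y j - (Num.floor (y j))%:~R - x) - j%:R * (q%:R * alpha - p%:~R).
    by rewrite /f intrD mulrNz !intrM -!pmulrn /y; lra.
  have {}h1 : q%:R * (k%:R / Q%:R - x) <= q%:R * (y j - (Num.floor (y j))%:~R - x).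
    by rewrite ler_pM2l// lerD2r ler_pdivrMr// mulrC.
  have {}h2 : q%:R * (y j - (Num.floor (y j))%:~R - x) <= q%:R * ((k%:R + 1) / Q%:R - x).
    by rewrite ler_pM2l// lerD2r ler_pdivlMr// mulrC ltW.
  by move: e1; rewrite ler_norml => /andP[e1 e2]; apply/andP; split; lra.
have : #|J|%:R <= q%:R / Q%:R + 3 :> R.
  have le1 : q%:R * (k%:R / Q%:R - x) - 1 <= q%:R * ((k%:R + 1) / Q%:R - x) + 1.
    have : q%:R * (k%:R / Q%:R - x) <= q%:R * ((k%:R + 1) / Q%:R - x).
      by rewrite ler_pM2l// lerD2r ler_pM2r ?invr_gt0// lerDl.
    lra.
  have := card_integers_itv le1 finj fJ; rewrite !mulrBr !mulrDl mulrDr mul1r; lra.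
rewrite -(ler_int R) intrM -ler_pdivlMl// => /le_trans; apply.
by rewrite intrD intrM -!pmulrn mulrDr mulrCA mulVf ?gt_eqF// mulr1 [leLHS]addrC [in leLHS]mulrC addrC.
Qed.

(** The entries add up to [q] and none exceeds [q / Q + 3], so none can be
    smaller than [q / Q - 3 (Q - 1)]. *)
Lemma birkhoff_spread (R : realType) (Q : nat) (alpha c : R) (q : nat) (p : int)
    (x : R) (k l : 'Z_Q) : (1 < Q)%N -> good_denominator Q alpha c q p ->
  birkhoff Q alpha q x k - birkhoff Q alpha q x l <= 3 * Q%:Z.
Proof.
move=> Q1 good; have bl := birkhoff_le x _ Q1 good.
have := sum_birkhoff Q alpha q x; rewrite (bigD1 l)//= => sE.
have : \sum_(i : 'Z_Q | i != l) Q%:Z * birkhoff Q alpha q x i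
     <= \sum_(i : 'Z_Q | i != l) (q%:Z + 3 * Q%:Z).
  by apply: ler_sum => i _; exact: bl.
have cQ : #|{: 'Z_Q}| = Q by rewrite card_ord Zp_cast.
rewrite -mulr_sumr sumr_const cardC1 cQ => h.
have {}h : Q%:Z * (q%:Z - birkhoff Q alpha q x l) <= (q%:Z + 3 * Q%:Z) * Q.-1%:Z.
  rewrite -{1}sE addrAC subrr add0r; move: h; rewrite -[leRHS]mulr_natr [Q.-1%:R]natz; exact.
have hk := bl k.
have : Q%:Z * (birkhoff Q alpha q x k - birkhoff Q alpha q x l) <= Q%:Z * (3 * Q%:Z).
  have QE : Q.-1%:Z = Q%:Z - 1 by rewrite -[in RHS](prednK (ltnW Q1)); lia.
  by move: h hk; rewrite QE; nia.
by rewrite ler_pM2l// ltz_nat ltnW.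
Qed.

Lemma floor_eq_near (R : realType) (y s e : R) :
  (forall l : int, e <= `|y - l%:~R|) -> `|s| < e ->
  Num.floor (y + s) = Num.floor y.
Proof.
move=> far se; apply: floor_def.
have := far (Num.floor y); have := far (Num.floor y + 1).
have := floor_le y; have := floorD1_gt y; rewrite !intrD.
move: (Num.floor y)%:~R se => f; rewrite ltr_norml => /andP[s1 s2] h1 h2.
rewrite ler0_norm; last lra.
rewrite ger0_norm; last lra.
by move=> h3 h4; apply/andP; split; lra.
Qed.

(** The points [j p / q] run through all multiples of [1 / q] modulo 1, and
    [j alpha] is within [1 / q] of [j p / q] for [j < q]. *)
Lemma orbit_dense (R : realType) (alpha x : R) (q : nat) (p : int) :
  (0 < q)%N -> coprimez p q -> q%:R * `|q%:R * alpha - p%:~R| <= 1 ->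
  exists2 j : 'I_q, True & exists m : int,
    `|j%:R * alpha - m%:~R - x| <= 2 / q%:R.
Proof.
move=> q0 pq qp; have qR : 0 < q%:R :> R by rewrite ltr0n.
pose i := Num.floor (q%:R * x).
have [u [v uvE]] := Bezoutz p q; move/eqP: pq => pq; rewrite pq in uvE.
have jq : (`|((i * u) %% q%:Z)%Z| < q)%N.
  by rewrite -ltz_nat gez0_abs ?modz_ge0 ?ltz_pmod// lt0r_neq0//.
exists (Ordinal jq) => //=; set j := `|_|%N.
have jE : j%:Z = i * u - ((i * u) %/ q%:Z)%Z * q%:Z.
  by rewrite /j gez0_abs ?modz_ge0 ?lt0r_neq0//; have := divz_eq (i * u) q; lia.
pose m := - i * v - ((i * u) %/ q%:Z)%Z * p.
exists m.
have mE : q%:Z * m = j%:Z * p - i.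
  have : i = i * u * p + i * v * q%:Z by rewrite -!mulrA -mulrDr uvE mulr1.
  by rewrite jE /m; move: (_ %/ _)%Z => r; nia.
have mER : q%:R * m%:~R = j%:R * p%:~R - i%:~R :> R.
  by move/(congr1 (fun z : int => z%:~R : R)): mE; rewrite intrD mulrNz !intrM -!pmulrn.
have jqR : j%:R <= q%:R :> R by rewrite ler_nat ltnW.
rewrite ler_pdivlMr//.
have -> : `|j%:R * alpha - m%:~R - x| * q%:R =
   `|j%:R * (q%:R * alpha - p%:~R) + (i%:~R - q%:R * x)|.
  rewrite -[X in _ * X]gtr0_norm// -normrM; congr `|_|.
  by rewrite !mulrBl [m%:~R * _]mulrC mER; lra.
rewrite (le_trans (ler_normD _ _))// (_ : 2 = 1 + 1)// lerD//.
  by rewrite normrM (le_trans _ qp)// normr_nat ler_wpM2r.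
have := floor_le (q%:R * x); have := floorD1_gt (q%:R * x); rewrite intrD -/i.
by move=> h1 h2; rewrite ler0_norm; lra.
Qed.

Lemma good_denominator_le1 (R : realType) (Q : nat) (alpha c : R) (q : nat)
  (p : int) : (0 < Q)%N -> good_denominator Q alpha c q p -> c <= 1.
Proof.
move=> Q0 [q0 _ qp /(_ q p)]; rewrite q0 leq_pmull// => /(_ isT) h.
exact: le_trans h qp.
Qed.

Lemma cell_int_shift (R : realType) (Q : nat) (k : 'Z_Q) (s : R) : (1 < Q)%N ->
  `|s| < Q%:R^-1 ->
  cell Q (k%:R / Q%:R + s) = if 0 <= s then k else k - 1.
Proof.
move=> Q1; have QR : 0 < Q%:R :> R by rewrite ltr0n ltnW.
move=> sQ'; have sQ : `|Q%:R * s| < 1.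
  by rewrite normrM gtr0_norm// -ltr_pdivlMl// mulr1.
rewrite /cell mulrDr mulrCA divff ?gt_eqF// mulr1 floorDzr ?natr_int//.
have -> : Num.floor (k%:R : R) = k%:Z by rewrite pmulrn intrKfloor.
rewrite intrD -pmulrn natr_Zp.
move: sQ; rewrite ltr_norml => /andP[s1 s2]; case: ifPn => s0.
  rewrite [Num.floor _](@floor_def _ _ 0) ?addr0//.
  by rewrite mulr_ge0// ltW.
rewrite [Num.floor _](@floor_def _ _ (-1)) ?mulrNz//.
by rewrite ltW// pmulr_rlt0// ltNge.
Qed.

(** Choose [j < q] and [z] within [2 / q] of [x] such that [z + j alpha] is the
    endpoint [k / Q] of a cell. Along the rest of the orbit of [z], another point
    close to a multiple of [1 / Q] would make [Q (i - j) alpha] close to an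
    integer, which a good denominator excludes. So near [z] only the [j]-th term
    of the sum varies. *)
Lemma birkhoff_jump (R : realType) (Q : nat) (alpha c : R) (q : nat) (p : int)
    (x : R) (k : 'Z_Q) : (1 < Q)%N -> good_denominator Q alpha c q p ->
  exists z w, `|z - x| <= 2 / q%:R /\
    forall t, 0 < t < c / (Q%:R * q%:R) ->
      birkhoff Q alpha q (z + t) = w + basis_vector k /\
      birkhoff Q alpha q (z - t) = w + basis_vector (k - 1).
Proof.
move=> Q1 good; have c1 := good_denominator_le1 (ltnW Q1) good.
case: good => q0 pq qp sep.
have qR : 0 < q%:R :> R by rewrite ltr0n.
have QR : 0 < Q%:R :> R by rewrite ltr0n ltnW.
have [j _ [m jm]] := orbit_dense (k%:R / Q%:R - x) q0 pq qp.
pose z := k%:R / Q%:R - (j%:R * alpha - m%:~R).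
have zj i : z + i%:R * alpha = k%:R / Q%:R + (i%:R - j%:R) * alpha + m%:~R by rewrite /z; lra.
have near i s : i != j -> `|s| < c / (Q%:R * q%:R) ->
    cell Q (z + s + i%:R * alpha) = cell Q (z + i%:R * alpha).
  move=> ij sc; rewrite /cell addrAC mulrDr (@floor_eq_near _ _ _ (c / q%:R))//.
    move=> l; rewrite ler_pdivrMr// mulrC zj.
    pose l' := l - k%:Z - Q%:Z * m.
    have -> : Q%:R * (k%:R / Q%:R + (i%:R - j%:R) * alpha + m%:~R) - l%:~R
       = Q%:R * (i%:R - j%:R) * alpha - l'%:~R.
      rewrite /l' !mulrDr mulrCA divff ?gt_eqF// mulr1 !intrD !mulrNz intrM -!pmulrn; lra.
    have [iltj|jlti|ijE] := ltngtP i j; last by rewrite (val_inj ijE) eqxx in ij.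
      rewrite -normrN (_ : - (_) = (Q * (j - i))%:R * alpha - (- l')%:~R); last first.
        by rewrite natrM natrB 1?ltnW// mulrNz; lra.
      apply: sep; rewrite muln_gt0 subn_gt0 iltj ltnW//= leq_mul2l; apply/orP; right.
      by rewrite (leq_trans (leq_subr _ _))// ltnW.
    rewrite (_ : Q%:R * _ = (Q * (i - j))%:R); last by rewrite natrM natrB 1?ltnW.
    apply: sep; rewrite muln_gt0 subn_gt0 jlti ltnW//= leq_mul2l; apply/orP; right.
    by rewrite (leq_trans (leq_subr _ _))// ltnW.
  rewrite normrM gtr0_norm// -ltr_pdivlMl// mulrCA -invfM//.
exists z, (\sum_(i < q | i != j) basis_vector (cell Q (z + i%:R * alpha))).
split; first by rewrite -normrN (le_trans _ jm)// le_eqVlt; apply/orP; left; apply/eqP; congr `|_|; rewrite /z; lra.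
move=> t /andP[t0 tc].
have tQ : `|t| < Q%:R^-1.
  rewrite gtr0_norm// (lt_le_trans tc)// invfM mulrCA ler_piMr ?invr_ge0 ?(ltW QR)//.
  by rewrite ler_pdivrMr// mul1r (le_trans c1)// ler1n.
have tc' : `|t| < c / (Q%:R * q%:R) by rewrite gtr0_norm.
have E s : `|s| < c / (Q%:R * q%:R) -> birkhoff Q alpha q (z + s) = 
   \sum_(i < q | i != j) basis_vector (cell Q (z + i%:R * alpha)) + basis_vector (cell Q (k%:R / Q%:R + s)).
  move=> sc; rewrite /birkhoff (bigD1 j)//= addrC; congr (_ + _).
    by apply: eq_bigr => i ij; rewrite near.
  by rewrite addrAC zj subrr mul0r addr0 addrAC cellDz.
rewrite !E ?normrN// !cell_int_shift ?normrN//.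
by rewrite ltW// leNgt oppr_lt0 t0.
Qed.

(** A Birkhoff sum at a good denominator is determined up to a constant vector by
    the differences of its entries, which lie between [- 3 Q] and [3 Q]. *)
Definition code (Q : nat) (b : {ffun 'Z_Q -> int}) : {ffun 'Z_Q -> 'I_(6 * Q).+1} :=
  [ffun i => inord `|(b i - b 0 + 3 * Q%:Z)%R|%N].

Definition decode (Q : nat) (v : {ffun 'Z_Q -> 'I_(6 * Q).+1}) : {ffun 'Z_Q -> int} :=
  [ffun i => (v i)%:Z - 3 * Q%:Z].

Definition constant_vector (Q : nat) (z : int) : {ffun 'Z_Q -> int} := [ffun=> z].

Lemma birkhoff_codeK (R : realType) (Q : nat) (alpha c : R) (q : nat) (p : int)
    (x : R) : (1 < Q)%N -> good_denominator Q alpha c q p ->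
  let b := birkhoff Q alpha q x in b = decode (code b) + constant_vector Q (b 0).
Proof.
move=> Q1 good b; apply/ffunP => i.
rewrite [RHS]ffunE [decode _ i]ffunE [constant_vector _ _ _]ffunE [code _ i]ffunE.
have h1 : b i - b 0 <= 3 * Q%:Z by exact: (birkhoff_spread _ _ _ Q1 good).
have h2 : b 0 - b i <= 3 * Q%:Z by exact: (birkhoff_spread _ _ _ Q1 good).
move: (b i) (b 0) h1 h2 => bi b0 h1 h2.
rewrite inordK; first by rewrite gez0_abs; lia.
by rewrite ltnS -lez_nat gez0_abs; lia.
Qed.

(** * Lebesgue points and rotations of the line *)

Lemma lebesgue_measure_shift (R : realType) (a : R) (A : set R) : measurable A ->
  lebesgue_measure ((fun x => x + a) @^-1` A) = lebesgue_measure A.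
Proof.
move=> mA.
have mf : measurable_fun setT (fun x : measurableTypeR R => (x + a : measurableTypeR R)).
  exact: measurable_funD.
pose f : {mfun measurableTypeR R >-> measurableTypeR R} := HB.pack (fun x => x + a) (isMeasurableFun.Build _ _ _ _ _ mf).
transitivity (pushforward (@lebesgue_measure R) f A) => //.
apply/esym/lebesgue_measure_unique => //= _ [[b c]] _ <-.
rewrite /pushforward.
have -> : f @^-1` [set` `]b, c]%R] = [set` `](b - a), (c - a)]%R].
  by apply/seteqP; split => x /=; rewrite !in_itv/= ltrBlDr lerBrDr.
rewrite !lebesgue_measure_itv/= !lte_fin ltrD2r; case: ifP => // _.
by rewrite -!EFinB; congr (_%:E); lra.
Qed.

(** Markov's inequality for the averages defining a Lebesgue point. *)
Lemma lebesgue_pt_deviation (R : realType) (f : R -> R) (x e eta : R) :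
  measurable_fun setT f -> lebesgue_pt f x -> 0 < e -> 0 < eta ->
  exists2 r0, 0 < r0 & forall r, 0 < r < r0 ->
    (lebesgue_measure (ball x r `&` [set y | (e <= `|f y - f x|)%R])
      <= (eta * r)%:E)%E.
Proof.
move=> mf fx e0 eta0.
have d0 : 0 < e * eta / 2 by rewrite divr_gt0 ?mulr_gt0.
have : \forall r \near 0^'+, (davg f x r < (e * eta / 2)%:E)%E.
  apply: (fx [set y | (y < (e * eta / 2)%:E)%E]); apply: open_nbhs_nbhs.
  by split; [exact: open_ereal_lt_ereal|rewrite /= lte_fin].
move=> [/= r0 r00 H]; exists r0 => // r /andP[r_gt0 rr0].
have {H} := H r _ r_gt0; rewrite /= sub0r normrN gtr0_norm// => /(_ rr0).
rewrite /davg /iavg (lebesgue_measure_ball _ (ltW r_gt0)) inver mulrn_eq0/= gt_eqF//.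
have r2 : 0 < (r *+ 2)^-1 by rewrite invr_gt0 mulrn_wgt0.
rewrite -lte_pdivlMl ?invr_gt0 ?mulrn_wgt0// => /ltW h.
have mg : measurable_fun (ball x r) (fun y => ((center (f x) \o f) y)%:E).
  apply/measurable_EFinP; apply: measurable_funTS.
  by apply: measurable_funB.
have := @le_integral_comp_abse _ _ _ (@lebesgue_measure R) _ (measurable_ball x r)
  (fun y => ((center (f x) \o f) y)%:E) e id (@measurable_id _ _ _)
  (fun r h => h) (fun _ _ _ _ h => h) mg e0.
move=> /le_trans /(_ h).
rewrite -lee_pdivlMl// -!EFinM.
move=> /le_trans; apply.
rewrite lee_fin invrK [X in e^-1 * X](_ : _ = e * (eta * r)); last by rewrite mulr2n; lra.
by rewrite mulKf ?gt_eqF.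
Qed.

(** Let [f] and [h] agree, up to a shift, on intervals that fill a fixed proportion
    of small balls around [x1] and [x2]. In such balls [f] is close to [f x1] and
    [h] is close to [h x2] outside a set of arbitrarily small proportion, so both
    approximations hold at a common point of the interval. *)
Lemma lebesgue_pt_unique (R : realType) (f h : R -> R) (x1 x2 a : R) :
  0 < a -> measurable_fun setT f -> measurable_fun setT h ->
  lebesgue_pt f x1 -> lebesgue_pt h x2 ->
  (forall e, 0 < e -> exists r y s, [/\ 0 < r < e,
     forall t, y < t < y + a * r -> ball x1 r t,
     forall t, y < t < y + a * r -> ball x2 r (t + s) &
     {ae @lebesgue_measure R, forall t, y < t < y + a * r -> f t = h (t + s)}]) ->
  f x1 = h x2.
Proof.
move=> a0 mf mh fx hx H; apply/eqP; rewrite -subr_eq0 -normr_eq0; apply/negPn/negP => n0.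
pose e := `|f x1 - h x2| / 2.
have e0 : 0 < e by rewrite divr_gt0// lt_def n0/=.
have a4 : 0 < a / 4 by rewrite divr_gt0.
have [r1 r10 D1] := lebesgue_pt_deviation mf fx e0 a4.
have [r2 r20 D2] := lebesgue_pt_deviation mh hx e0 a4.
have [|r [y [s [/andP[r_gt0 rlt] I1 I2 E]]]] := H (Num.min r1 r2).
  by rewrite lt_min r10.
move: rlt; rewrite lt_min => /andP[rr1 rr2].
have [N [mN N0 EN]] := E.
pose B1 := ball x1 r `&` [set y | (e <= `|f y - f x1|)%R].
pose B2 := ball x2 r `&` [set y | (e <= `|h y - h x2|)%R].
have mB (g : R -> R) (x : R) : measurable_fun setT g ->
    measurable (ball x r `&` [set y | (e <= `|g y - g x|)%R]).
  move=> mg; apply: measurableI; first exact: measurable_ball.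
  rewrite -[X in measurable X]setTI.
  have -> : [set y | e <= `|g y - g x|] = (fun y => `|g y - g x|) @^-1` `[e, +oo[.
    by apply/seteqP; split => z /=; rewrite in_itv/= andbT.
  by apply: measurableT_comp => //; exact: measurable_funB.
have mB1 : measurable B1 by exact: mB.
have mB2 : measurable B2 by exact: mB.
have mB2s : measurable ((fun x => x + s) @^-1` B2).
  rewrite -[X in measurable X]setTI.
  have mf' : measurable_fun setT (fun x : R => x + s) by exact: measurable_funD.
  exact: mf'.
have sub : `]y, (y + a * r)[%classic `<=` B1 `|` ((fun x => x + s) @^-1` B2) `|` N.
  move=> t /=; rewrite in_itv/= => It.
  have [tN|tN] := pselect (N t); [by right|left].
  have fh : f t = h (t + s) by apply: contrapT => fh; apply: tN; apply: EN => /(_ It).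
  have [b1|b1] := leP e `|f t - f x1|; first by left; split => //; exact: I1.
  right; split; first exact: I2.
  rewrite /= leNgt; apply/negP; rewrite -fh => b2.
  have : `|f x1 - h x2| <= `|f t - f x1| + `|f t - h x2|.
    rewrite (distrC (f t) (f x1)) (_ : f x1 - h x2 = (f x1 - f t) + (f t - h x2)); last by lra.
    exact: ler_normD.
  by rewrite leNgt => /negP; apply; move: b1 b2; rewrite /e; lra.
have : (lebesgue_measure [set` `]y, y + a * r[%R] <= (a / 4 * r)%:E + (a / 4 * r)%:E)%E.
  apply: (@le_trans _ _ (lebesgue_measure (B1 `|` ((fun x => x + s) @^-1` B2) `|` N))).
    apply: le_measure => //; rewrite inE//; last by do 2 apply: measurableU => //.
  apply: (le_trans (measureU2 _ _ _)) => //; first exact: measurableU.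
  rewrite [X in (_ + X)%E]N0 adde0.
  apply: (le_trans (measureU2 _ _ _)) => //.
  apply: leeD; first by apply: D1; rewrite r_gt0.
  apply: (@le_trans _ _ (lebesgue_measure B2)).
    by rewrite le_eqVlt; apply/orP; left; apply/eqP; exact: lebesgue_measure_shift.
  by apply: D2; rewrite r_gt0.
rewrite lebesgue_measure_itv/= lte_fin ltrDl mulr_gt0// -EFinB -EFinD lee_fin.
have : 0 < a * r by rewrite mulr_gt0.
by lra.
Qed.

Lemma ae_real_imp (R : realType) (P Q : R -> Prop) : (forall x, P x -> Q x) ->
  {ae @lebesgue_measure R, forall x, P x} ->
  {ae @lebesgue_measure R, forall x, Q x}.
Proof.
by move=> PQ; apply: (@filterS _ _ (ae_filter_ringOfSetsType (@lebesgue_measure R))).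
Qed.

Lemma ae_real_imp2 (R : realType) (P Q S : R -> Prop) :
  (forall x, P x -> Q x -> S x) ->
  {ae @lebesgue_measure R, forall x, P x} ->
  {ae @lebesgue_measure R, forall x, Q x} ->
  {ae @lebesgue_measure R, forall x, S x}.
Proof.
by move=> PQ; apply: (@filterS2 _ _ (ae_filter_ringOfSetsType (@lebesgue_measure R))).
Qed.

Lemma ae_real_forall (R : realType) (I : countType) (P : I -> R -> Prop) :
  (forall i, {ae @lebesgue_measure R, forall x, P i x}) ->
  {ae @lebesgue_measure R, forall x, forall i, P i x}.
Proof.
move=> H; have H' (n : nat) : {ae @lebesgue_measure R, forall x, 
    forall i, unpickle n = Some i -> P i x}.
  case E : (unpickle n) => [i|]; last by apply: aeW => x i.
  by apply: ae_real_imp (H i) => x Px j [<-].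
apply: ae_real_imp (@ae_foralln _ _ _ (@lebesgue_measure R) (fun n x => forall i, unpickle n = Some i -> P i x) H').
by move=> x h i; apply: (h (pickle i)); rewrite pickleK.
Qed.

Lemma ae_shift (R : realType) (a : R) (P : set R) :
  {ae @lebesgue_measure R, forall x, P x} ->
  {ae @lebesgue_measure R, forall x, P (x + a)}.
Proof.
move=> [N [mN N0 sub]].
have mf : measurable_fun setT (fun x : R => x + a) by exact: measurable_funD.
exists ((fun x : R => x + a) @^-1` N); split.
- by rewrite -[X in measurable X]setTI; exact: mf.
- by rewrite -N0; exact: lebesgue_measure_shift.
- by move=> x /= Px; exact: sub.
Qed.

Lemma bounded_lebesgue_pt (R : realType) (f : R -> R) (C : R) :
  measurable_fun setT f -> (forall x, `|f x| <= C) ->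
  {ae @lebesgue_measure R, forall x, lebesgue_pt f x}.
Proof.
move=> mf fC; apply: lebesgue_differentiation; split => //; first exact: openT.
move=> K _ cK; have mK := compact_measurable cK.
apply: (@le_lt_trans _ _ (\int[lebesgue_measure]_(x in K) C%:E)%E).
  apply: ge0_le_integral => //.
  - apply/measurable_EFinP; apply: measurable_funTS; exact: measurableT_comp.
  - by move=> x _; rewrite lee_fin (le_trans _ (fC x)).
rewrite integral_cst//; apply: lte_mul_pinfty => //; last exact: compact_finite_measure.
by rewrite lee_fin (le_trans _ (fC 0)).
Qed.

(** A multiple [q beta] closer than [e] to an integer [p] is a step that, repeated from
    a neighbouring integer of [y] on the proper side, comes within [e] of [y]. *)
Lemma irrational_dense (R : realType) (beta y e : R) : irrational beta -> 0 < e ->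
  exists (n : nat) (b : int), `|n%:R * beta + b%:~R - y| < e.
Proof.
move=> irr e0; pose N := (Num.truncn e^-1).+1.
have [q [p [q0 _ small]]] := dirichlet beta (ltn0Sn (Num.truncn e^-1)).
have qR : 0 < q%:R :> R by rewrite ltr0n.
have Ne : e^-1 < N%:R by exact: truncnS_gt.
pose d := q%:R * beta - p%:~R.
have dn0 : d != 0.
  rewrite subr_eq0; apply/eqP => dE; apply: irr; apply/rationalP.
  by exists p, q; rewrite -dE mulrC mulKf ?gt_eqF.
have de : `|d| < e.
  have N0 : 0 < N%:R :> R by rewrite ltr0n.
  rewrite -(ltr_pM2l N0) (lt_trans small)// -ltr_pdivrMr// mul1r; exact: Ne.
pose b0 := if 0 < d then Num.floor y else Num.floor y + 1.
pose i := Num.truncn ((y - b0%:~R) / d).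
have x0 : 0 <= (y - b0%:~R) / d.
  rewrite /b0; case: ifPn => d0; first by apply: divr_ge0; [rewrite subr_ge0 floor_le|exact: ltW].
  rewrite -mulrNN mulr_ge0//; last by rewrite -invrN invr_ge0 oppr_ge0 leNgt.
  by rewrite oppr_ge0 subr_le0 ltW// floorD1_gt.
exists (i * q)%N, (b0 - i%:Z * p).
have -> : (i * q)%:R * beta + (b0 - i%:Z * p)%:~R - y = d * (i%:R - (y - b0%:~R) / d).
  rewrite mulrBr mulrCA divff// mulr1 natrM intrD mulrNz intrM -!pmulrn /d; lra.
rewrite normrM (le_lt_trans _ de)// -[leRHS]mulr1 ler_wpM2l//.
have : i%:R <= (y - b0%:~R) / d by rewrite truncn_le.
have := truncnS_gt ((y - b0%:~R) / d); rewrite -/i -natr1.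
by move=> h1 h2; rewrite ler0_norm; lra.
Qed.

Lemma lebesgue_ae_ex (R : realType) (P : set R) :
  {ae @lebesgue_measure R, forall x, P x} -> exists x, P x.
Proof.
move=> [N [mN N0 sub]]; apply: contrapT => nP.
have : (lebesgue_measure `[0%R, 1%R]%classic <= lebesgue_measure N)%E.
  apply: le_measure => //; rewrite ?inE// => x _.
  by apply: sub => /= Px; apply: nP; exists x.
by rewrite N0 lebesgue_measure_itv/= lte_fin ltr01 -EFinB subr0 lee_fin ler10.
Qed.

(** The values at two Lebesgue points agree, because a multiple of [beta] carries a
    neighbourhood of one almost onto that of the other. *)
Lemma irrational_rotation_ergodic (R : realType) (f : R -> R) (C beta : R) :
  irrational beta -> measurable_fun setT f -> (forall x, `|f x| <= C) ->
  (forall (x : R) (n : int), f (x + n%:~R) = f x) ->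
  {ae @lebesgue_measure R, forall x, f (x + beta) = f x} ->
  exists kappa, {ae @lebesgue_measure R, forall x, f x = kappa}.
Proof.
move=> irr mf fC f1 fbeta; have fpt := bounded_lebesgue_pt mf fC.
have {fbeta} inv n : {ae @lebesgue_measure R, forall x, f (x + n%:R * beta) = f x}.
  elim: n => [|n IH]; first by apply: aeW => x; rewrite mul0r addr0.
  apply: ae_real_imp2 IH (ae_shift (n%:R * beta) fbeta) => x <- <-.
  by rewrite -natr1 mulrDl mul1r addrA.
have [x0 px0] := lebesgue_ae_ex fpt; exists (f x0).
apply: ae_real_imp fpt => x px; apply/esym.
have a0 : 0 < 2^-1 :> R by rewrite invr_gt0.
apply: (lebesgue_pt_unique a0 mf mf px0 px) => e e0.
have e4 : 0 < e / 4 by rewrite divr_gt0.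
have [n [b nb]] := irrational_dense (x - x0) irr e4.
exists (e / 2), x0, (n%:R * beta + b%:~R); split.
- by apply/andP; split; lra.
- by move=> t /andP[t1 t2]; rewrite /ball/= ltr_norml; apply/andP; split; lra.
- move=> t /andP[t1 t2]; rewrite /ball/= ltr_norml.
  by move: nb; rewrite ltr_norml => /andP[h1 h2]; apply/andP; split; lra.
- by apply: ae_real_imp (inv n) => t <- _; rewrite addrA f1.
Qed.

(** * Families of functions equivariant under a rotation *)

Lemma infinitely_often_pigeonhole (T : finType) (F : nat -> T) :
  exists v, forall N : nat, exists2 n, (N <= n)%N & F n = v.
Proof.
apply: contrapT => H.
have /choice[N HN] : forall v, exists N : nat, forall n, (N <= n)%N -> F n <> v.
  move=> v; apply: contrapT => H'; apply: H; exists v => N; apply: contrapT => H2.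
  by apply: H'; exists N => n Nn Fn; apply: H2; exists n.
by apply: (HN (F (\max_v N v)) (\max_v N v)) => //; exact: leq_bigmax.
Qed.

Lemma basis_invariance (Q : nat) (T : Type) (h : {ffun 'Z_Q -> int} -> T) :
  (forall m k, h (m + basis_vector k) = h m) -> forall m, h m = h 0.
Proof.
move=> H.
have Hn m k (n : nat) : h (m + basis_vector k *+ n) = h m.
  by elim: n => [|n IH]; rewrite ?mulr0n ?addr0// mulrSr addrA H.
have Hz m k (z : int) : h (m + basis_vector k *~ z) = h m.
  case: z => n; first exact: Hn.
  by rewrite NegzE mulrNz -[LHS](Hn _ k n.+1) -pmulrn subrK.
move=> m; have -> : m = 0 + \sum_k basis_vector k *~ m k.
  rewrite add0r; apply/ffunP => l; rewrite sum_ffunE (bigD1 l)//= ffunMzE ffunE eqxx.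
  rewrite big1 ?addr0 ?intz// => k kl.
  by rewrite ffunMzE ffunE (negbTE kl) mul0rz.
elim: (index_enum _) => [|k s IH]; first by rewrite big_nil addr0.
by rewrite big_cons [_ *~ _ + _]addrC addrA Hz.
Qed.

(** In the application [g m x] is the measure of a piece, translated according to
    [m], of the section over [x] of an invariant set: the last clause is the
    invariance, the one before it holds since the step function is centered. *)
Definition equivariant_family (R : realType) (Q : nat) (alpha : R)
    (g : {ffun 'Z_Q -> int} -> R -> R) (C : R) :=
  [/\ forall m, measurable_fun setT (g m),
      forall m x, `|g m x| <= C,
      forall m x (n : int), g m (x + n%:~R) = g m x,
      forall m z x, g (m + constant_vector Q z) x = g m x &
      {ae @lebesgue_measure R, forall x, forall m,
        g m (x + alpha) = g (m + basis_vector (cell Q x)) x}].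

Lemma equivariant_birkhoff (R : realType) (Q : nat) (alpha : R)
    (g : {ffun 'Z_Q -> int} -> R -> R) (C : R) :
  equivariant_family alpha g C ->
  {ae @lebesgue_measure R, forall x, forall q m,
    g m (x + q%:R * alpha) = g (m + birkhoff Q alpha q x) x}.
Proof.
move=> [_ _ _ _ coc]; apply: (ae_real_forall (I := nat)) => q.
elim: q => [|q IH].
  by apply: aeW => x m; rewrite mul0r addr0 /birkhoff big_ord0 addr0.
apply: ae_real_imp2 IH (ae_shift (q%:R * alpha) coc) => x IH E m.
rewrite -natr1 mulrDl mul1r addrA E IH -addrA; congr (g (_ + _) _).
by rewrite /birkhoff big_ord_recr/= addrC.
Qed.

(** Near [x], the sums of order [q] for good [q] equal [b = w + e_k] to the right of
    the jump and [b - e_k + e_(k-1)] to its left. Modulo constant vectors [b] is the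
    same vector [d] for infinitely many [q]. On each side [g m] translated by
    [q alpha - p] is [g (m + d')] with [d'] the corresponding vector, whence
    [g (m + d') x = g m x] by comparison at Lebesgue points. *)
Lemma equivariant_jump (R : realType) (Q : nat) (alpha : R)
    (g : {ffun 'Z_Q -> int} -> R -> R) (C : R) : (1 < Q)%N ->
  SBAD R Q alpha -> equivariant_family alpha g C ->
  {ae @lebesgue_measure R, forall x, forall m k,
    g (m + basis_vector k) x = g (m + basis_vector (k - 1)) x}.
Proof.
move=> Q1 Salpha eqv; have birk := equivariant_birkhoff eqv.
case: eqv => mg gC g1 gcst _.
have [c c0 good] := SBAD_good_denominator (ltnW Q1) Salpha.
have QR : 0 < Q%:R :> R by rewrite ltr0n ltnW.
have Leb : {ae @lebesgue_measure R, forall x, forall m, lebesgue_pt (g m) x}.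
  by apply: ae_real_forall => m; exact: bounded_lebesgue_pt (mg m) (gC m).
apply: ae_real_imp Leb => x Leb m0 k.
have {good} /choice[F HF] : forall n : nat, exists u : nat * int * (R * {ffun 'Z_Q -> int}),
    [/\ (n < u.1.1)%N, good_denominator Q alpha c u.1.1 u.1.2, `|u.2.1 - x| <= 2 / u.1.1%:R &
    forall t, 0 < t < c / (Q%:R * u.1.1%:R) ->
      birkhoff Q alpha u.1.1 (u.2.1 + t) = u.2.2 + basis_vector k /\
      birkhoff Q alpha u.1.1 (u.2.1 - t) = u.2.2 + basis_vector (k - 1)].
  move=> n; have [q nq [p good']] := good n.+1.
  have [z [w [zx H]]] := birkhoff_jump x k Q1 good'.
  by exists (q, p, (z, w)).
pose b n := (F n).2.2 + basis_vector k.
have bcodeK n : b n = decode (code (b n)) + constant_vector Q (b n 0).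
  have [_ gd _ H] := HF n; have [q0 _ _ _] := gd.
  have h : 0 < c / (Q%:R * (F n).1.1%:R) by rewrite divr_gt0// mulr_gt0// ltr0n.
  have [] := H (c / (Q%:R * (F n).1.1%:R) / 2).
    by rewrite divr_gt0//= ltr_pdivrMr// ltr_pMr// ltr1n.
  by rewrite /b => <- _; exact: birkhoff_codeK gd.
have [v Hv] := infinitely_often_pigeonhole (fun n => code (b n)).
pose d := decode v.
have codeE n : code (b n) = v -> b n = d + constant_vector Q (b n 0).
  by move=> cn; rewrite {1}bcodeK cn.
have a0 : 0 < c / (4 * Q%:R) by rewrite divr_gt0// mulr_gt0.
(* The comparison at [x], over an interval of length [c / (Q q)] inside the ball
   of radius [3 / q]. The balls below have radius [4 / q]: the extra [1 / q] makes
   room for the shift by [q alpha - p]. *)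
have inv d' : (forall n, code (b n) = v -> exists (y : R) (z : int),
    [/\ x - 3 / (F n).1.1%:R <= y, y + c / (Q%:R * (F n).1.1%:R) <= x + 3 / (F n).1.1%:R &
     forall t, y < t < y + c / (Q%:R * (F n).1.1%:R) ->
       birkhoff Q alpha (F n).1.1 t = d' + constant_vector Q z]) ->
    forall m, g (m + d') x = g m x.
  move=> H m; apply: (lebesgue_pt_unique a0 (mg _) (mg _) (Leb _) (Leb _)) => e e0.
  have [n Nn /H [y [z [y1 y2 E]]]] := Hv (Num.truncn (4 / e)).
  have [nq gd _ _] := HF n; have [q0 _ qp _] := gd.
  set q := (F n).1.1 in nq q0 qp y1 y2 E *; set p := (F n).1.2 in qp.
  have qR : 0 < q%:R :> R by rewrite ltr0n.
  have rhoE : c / (4 * Q%:R) * (4 / q%:R) = c / (Q%:R * q%:R).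
    by rewrite !invfM; lra.
  have {}qp : `|q%:R * alpha - p%:~R| <= 1 / q%:R by rewrite ler_pdivlMr// mulrC.
  have q1 : 0 < 1 / q%:R :> R by rewrite divr_gt0.
  rewrite -[3]mulr1 -mulrA in y1 y2.
  exists (4 * (1 / q%:R)), y, (q%:R * alpha - p%:~R).
  rewrite [4 * (1 / _)]mulrA mulr1 rhoE; split.
  - rewrite divr_gt0//= ltr_pdivrMr// mulrC -ltr_pdivrMr//.
    by rewrite (lt_le_trans (truncnS_gt _))// ler_nat (leq_ltn_trans Nn).
  - move=> t /andP[t1 t2]; rewrite /ball/= ltr_norml -[4]mulr1 -mulrA.
    by apply/andP; split; lra.
  - move=> t /andP[t1 t2]; rewrite /ball/= ltr_norml -[4]mulr1 -mulrA.
    by move: qp; rewrite ler_norml => /andP[? ?]; apply/andP; split; lra.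
  - apply: ae_real_imp birk => t birk /E bE.
    by rewrite addrA -mulrNz g1 birk bE addrA gcst.
have rho1 n : c / (Q%:R * (F n).1.1%:R) <= 1 / (F n).1.1%:R.
  have [nq gd _ _] := HF n; have c1 := good_denominator_le1 (ltnW Q1) gd.
  have qR : 0 < (F n).1.1%:R :> R by rewrite ltr0n (leq_trans _ nq).
  rewrite ler_pdivrMr ?mulr_gt0// mulrCA mul1r mulVf ?gt_eqF// mulr1.
  by rewrite (le_trans c1)// ler1n ltnW.
have split3 (q : nat) : 3 / q%:R = 2 / q%:R + 1 / q%:R :> R by rewrite -mulrDl natr1.
have right m : g (m + d) x = g m x.
  apply: inv => n cn; have [_ gd zx H] := HF n; have := rho1 n; rewrite split3.
  move: zx; rewrite ler_norml => /andP[z1 z2] rho.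
  exists (F n).2.1, (b n 0); split; [|lra|].
    by have [q0 _ _ _] := gd; have : 0 <= 1 / (F n).1.1%:R :> R by []; lra.
  move=> t /andP[t1 t2]; have [|E _] := H (t - (F n).2.1); first by apply/andP; split; lra.
  by move: E; rewrite addrC subrK => ->; rewrite -codeE.
have left m : g (m + (d - basis_vector k + basis_vector (k - 1))) x = g m x.
  apply: inv => n cn; have [_ gd zx H] := HF n; have := rho1 n; rewrite split3.
  move: zx; rewrite ler_norml => /andP[z1 z2] rho.
  exists ((F n).2.1 - c / (Q%:R * (F n).1.1%:R)), (b n 0); split; [lra| |].
    by have [q0 _ _ _] := gd; have : 0 <= 1 / (F n).1.1%:R :> R by []; lra.
  move=> t /andP[t1 t2]; have [|_] := H ((F n).2.1 - t); first by apply/andP; split; lra.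
  rewrite opprB addrC subrK => ->.
  rewrite -(addrA d) [RHS]addrAC -codeE// /b addrA addrK//.
rewrite -[LHS]left -[RHS]right.
congr (g _ x); rewrite -!addrA; congr (_ + _); rewrite addrCA addrA addrC.
by rewrite [d + _]addrC addrA (addrAC (- _)) addNr add0r.
Qed.

(** Once all basis vectors act alike, the [Q] steps from [x] to [x + Q alpha] act
    as the sum of all basis vectors, a constant vector. So every [g m] is invariant
    under an irrational rotation. *)
Lemma equivariant_constant (R : realType) (Q : nat) (alpha : R)
    (g : {ffun 'Z_Q -> int} -> R -> R) (C : R) : (1 < Q)%N ->
  SBAD R Q alpha -> equivariant_family alpha g C ->
  exists kappa, {ae @lebesgue_measure R, forall x, forall m, g m x = kappa}.
Proof.
move=> Q1 Salpha eqv; have jump := equivariant_jump Q1 Salpha eqv.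
have birk := equivariant_birkhoff eqv.
case: eqv => mg gC g1 gcst coc.
have {}jump : {ae @lebesgue_measure R, forall x, forall m k,
    g (m + basis_vector k) x = g (m + basis_vector 0) x}.
  apply: ae_real_imp jump => x H m k; rewrite -[k]natr_Zp.
  (* Going around [Z / Q] in unit steps connects every cell with cell [0]. *)
  elim: (k : nat) => [|n IH]; first by [].
  by rewrite H -natr1 addrK.
have irr : irrational (Q%:R * alpha).
  move=> /rationalP[a [b E]]; apply: (SBAD_irrational (ltnW Q1) Salpha).
  apply/rationalP; exists a, (b * Q)%N; rewrite natrM invfM mulrA -E mulrC mulrA mulVf ?mul1r//.
  by rewrite pnatr_eq0 -lt0n ltnW.
have /choice[kap Hkap] m : exists kappa, {ae @lebesgue_measure R, forall x, g m x = kappa}.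
  apply: (irrational_rotation_ergodic irr (mg m) (gC m) (g1 m)).
  apply: ae_real_imp2 jump birk => x J /(_ Q m) ->.
  pose G (n : {ffun 'Z_Q -> int}) := g n x.
  have sum0 (s : seq 'Z_Q) (m' : {ffun 'Z_Q -> int}) :
     g (m' + \sum_(k <- s) basis_vector k) x = g (m' + basis_vector 0 *+ size s) x.
    elim: s m' => [|k s IH] m'; first by rewrite big_nil mulr0n.
    by rewrite big_cons addrA IH addrAC J /= mulrSr addrA.
  rewrite /birkhoff -(big_map (fun j : 'I_Q => cell Q (x + j%:R * alpha)) xpredT (@basis_vector Q)) sum0.
  (* [Q] basis vectors, whichever they are, have the effect of one for each cell. *)
  have -> : size [seq cell Q (x + j%:R * alpha) | j : 'I_Q <- index_enum 'I_Q] =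
            size (index_enum 'Z_Q).
    by rewrite size_map -2!sum1_size !sum1_card !card_ord Zp_cast.
  rewrite -sum0 -[RHS](gcst m 1); congr (g (_ + _) _).
  apply/ffunP => l; rewrite sum_ffunE (bigD1 l)//= !ffunE eqxx big1 ?addr0// => k kl.
  by rewrite ffunE (negbTE kl).
have kinv m k : kap (m + basis_vector k) = kap m.
  have [x] := lebesgue_ae_ex (ae_real_imp2 (fun x => @conj _ _)
     (ae_real_imp2 (fun x => @conj _ _) (ae_shift alpha (Hkap m)) (Hkap (m + basis_vector k)))
     (ae_real_imp2 (fun x => @conj _ _) jump coc)).
  by move=> [[E1 E2] [J E]]; rewrite -E1 -E2 E J [in RHS]J.
exists (kap 0); apply: ae_real_forall => m; rewrite -(basis_invariance kinv m).
exact: Hkap.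
Qed.

(** * The circle *)

Lemma to_circleD (R : realType) (a b : R) : to_circle (a + b) = to_circle a + to_circle b.
Proof. exact: pi_addr. Qed.

Lemma to_circle_eq (R : realType) (a b : R) : a - b \is a Num.int ->
  to_circle a = to_circle b.
Proof.
move=> ab; pose Q := Quotient.quot (GRing.ZmodClosed.clone R (@Num.int_num_subdef R) _).
suff : \pi_Q%qT a = \pi_Q%qT b by [].
by apply/eqP; rewrite -Quotient.idealrBE.
Qed.

Lemma to_circleDz (R : realType) (a : R) (n : int) : to_circle (a + n%:~R) = to_circle a.
Proof. by apply: to_circle_eq; rewrite addrAC subrr add0r intr_int. Qed.

Lemma circle_fracK (R : realType) (x : circle R) : to_circle (circle_frac x) = x.
Proof. by rewrite /circle_frac -mulrNz to_circleDz; exact: reprK. Qed.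

Lemma circle_frac_itv (R : realType) (x : circle R) : 0 <= circle_frac x < 1.
Proof.
by rewrite subr_ge0 floor_le/= ltrBlDl; have := floorD1_gt (repr x); rewrite intrD.
Qed.

Lemma circle_open (R : realType) (U : set (circle R)) :
  open (@to_circle R @^-1` U) = open U.
Proof. by []. Qed.

Lemma measurable_circle_frac (R : realType) :
  measurable_fun setT (@circle_frac R : borel (circle R) -> R).
Proof.
apply: (measurability _ (RGenOInfty.measurableE R)) => //.
move=> _ [_ [t ->] <-]; rewrite setTI.
have [t0|t0] := ltP t 0.
  rewrite (_ : _ @^-1` _ = setT)//; apply/seteqP; split => // x _ /=.
  by rewrite in_itv/= andbT (lt_le_trans t0)//; have /andP[] := circle_frac_itv x.
apply: sub_sigma_algebra; rewrite -circle_open.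
rewrite (_ : _ @^-1` _ = \bigcup_(n : int) `]n%:~R + t, n%:~R + 1[%classic); last first.
  apply/seteqP; split => a /=; rewrite in_itv/= andbT circle_fracP.
    move=> ta; exists (Num.floor a) => //=; rewrite in_itv/=.
    by have := floorD1_gt a; rewrite intrD => ->; rewrite andbT; lra.
  move=> [n _ /=]; rewrite in_itv/= => /andP[h1 h2].
  by rewrite (@floor_def _ _ n) ?intrD; [lra|apply/andP; split; lra].
by apply: bigcup_open => n _; exact: interval_open.
Qed.

Lemma circle_measureE (R : realType) (C : set (borel (circle R))) :
  circle_measure C = lebesgue_measure ((@to_circle R @^-1` C) `&` `[0, 1[).
Proof. by []. Qed.

Lemma circle_measureT (R : realType) : circle_measure [set: borel (circle R)] = 1%E.
Proof.
by rewrite circle_measureE preimage_setT setTI lebesgue_measure_itv/= lte_fin ltr01 -EFinB subr0.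
Qed.

Lemma measurable_circle_preimage (R : realType) (C : set (borel (circle R))) :
  measurable C -> measurable (@to_circle R @^-1` C).
Proof. by move=> mC; rewrite -[X in measurable X]setTI; exact: measurable_to_circle. Qed.

(** A fundamental domain shifted by [a] in [[0, 1)] differs from [[0, 1)] by moving
    [[0, a)] to [[1, 1 + a)], where a periodic set looks the same. *)
Lemma circle_measure_rotation (R : realType) (alpha : R) (C : set (borel (circle R))) :
  measurable C ->
  circle_measure [set x | C (x + to_circle alpha)] = circle_measure C.
Proof.
move=> mC; rewrite !circle_measureE.
pose P := @to_circle R @^-1` C.
have mP : measurable P by exact: measurable_circle_preimage.
pose a := alpha - (Num.floor alpha)%:~R.
have a01 : 0 <= a < 1.
  by rewrite subr_ge0 floor_le/= ltrBlDl; have := floorD1_gt alpha; rewrite intrD.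
have -> : to_circle alpha = to_circle a by rewrite /a -mulrNz to_circleDz.
have mS (b : R) (D : set R) : measurable D -> measurable ((fun x : R => x + b) @^-1` D).
  move=> mD; rewrite -[X in measurable X]setTI.
  have mf : measurable_fun setT (fun x : R => x + b) by exact: measurable_funD.
  exact: mf.
case/andP: a01 => a0 a1.
transitivity (lebesgue_measure ((fun x => x + a) @^-1` (P `&` `[a, 1 + a[%classic))).
  congr lebesgue_measure; apply/seteqP; split => x /= [];
  rewrite /P /= to_circleD => xC; rewrite !in_itv/= lerDr ltrD2r => xi; split => //.
rewrite lebesgue_measure_shift; last by apply: measurableI.
rewrite (_ : P `&` _ = (P `&` `[a, 1[) `|` (P `&` `[1, 1 + a[)); last first.
  rewrite -setIUr; congr (_ `&` _); apply/seteqP; split => x /=; rewrite !in_itv/=.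
    by move=> /andP[-> ->]; have [x1|x1] := ltP x 1; [left|right].
  by case=> /andP[h1 h2]; apply/andP; split; lra.
rewrite (_ : P `&` `[0, 1[ = (P `&` `[a, 1[) `|` (P `&` `[0, a[)); last first.
  rewrite -setIUr; congr (_ `&` _); apply/seteqP; split => x /=; rewrite !in_itv/=.
    by move=> /andP[h1 ->]; have [x1|x1] := ltP x a; [right; rewrite h1|left].
  by case=> /andP[h1 h2]; apply/andP; split; lra.
rewrite measureU//=; [|exact: measurableI|exact: measurableI|]; last first.
  by rewrite -subset0 => x [[_ /=]]; rewrite !in_itv/= => /andP[_ h] [_ /=]; rewrite leNgt h.
rewrite [RHS]measureU//=; [|exact: measurableI|exact: measurableI|]; last first.
  by rewrite -subset0 => x [[_ /=]]; rewrite !in_itv/= => /andP[h _] [_ /=]; rewrite ltNge h andbF.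
congr (_ + _)%E.
rewrite -[LHS](lebesgue_measure_shift 1); last exact: measurableI.
congr lebesgue_measure; apply/seteqP; split => x /= [];
rewrite /P /= -[1]/(1%:~R) to_circleDz => xC; rewrite !in_itv/= => /andP[h1 h2]; split => //; apply/andP; split; lra.
Qed.

Lemma step_functionE (R : realType) (V : Type) (Q : nat) (Phi : 'Z_Q -> V) (a : R) :
  (1 < Q)%N -> step_function Phi (to_circle a) = Phi (cell Q a).
Proof.
by move=> Q1; rewrite /step_function circle_fracP -mulrNz -[RHS](congr1 Phi (cellDz a (- Num.floor a) Q1)).
Qed.

Lemma cell_itv (R : realType) (Q : nat) (a : R) (k : 'Z_Q) : (1 < Q)%N ->
  0 <= a < 1 -> (cell Q a = k) <-> (a \in `[k%:R / Q%:R, (k%:R + 1) / Q%:R[).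
Proof.
move=> Q1 /andP[a0 a1]; have QR : 0 < Q%:R :> R by rewrite ltr0n ltnW.
rewrite in_itv/= ler_pdivrMr// ltr_pdivlMr// [a * _]mulrC; split=> [/(cell_bounds Q1)|].
  have -> : Num.floor a = 0 by apply: floor_def; rewrite a0 a1.
  by rewrite subr0.
move=> h; rewrite /cell (@floor_def _ _ k%:Z) ?intrD -?pmulrn//.
by rewrite natr_Zp.
Qed.

Definition circle_cell (R : realType) (Q : nat) (k : 'Z_Q) : set (borel (circle R)) :=
  [set x | cell Q (circle_frac x) = k].
Arguments circle_cell R {Q} k.

Lemma circle_cellE (R : realType) (Q : nat) (k : 'Z_Q) : (1 < Q)%N ->
  circle_cell R k = @circle_frac R @^-1` `[k%:R / Q%:R, (k%:R + 1) / Q%:R[%classic.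
Proof.
by move=> Q1; apply/seteqP; split => x /=;
  rewrite /circle_cell /= (cell_itv k Q1 (circle_frac_itv x)).
Qed.

Lemma measurable_circle_cell (R : realType) (Q : nat) (k : 'Z_Q) : (1 < Q)%N ->
  measurable (circle_cell R k).
Proof.
move=> Q1; rewrite circle_cellE// -[X in measurable X]setTI.
by apply: measurable_circle_frac.
Qed.

Lemma circle_measure_cell (R : realType) (Q : nat) (k : 'Z_Q) : (1 < Q)%N ->
  circle_measure (circle_cell R k) = (Q%:R^-1)%:E.
Proof.
move=> Q1; have QR : 0 < Q%:R :> R by rewrite ltr0n ltnW.
rewrite circle_measureE.
rewrite (_ : _ `&` _ = `[k%:R / Q%:R, (k%:R + 1) / Q%:R[%classic).
  rewrite lebesgue_measure_itv/= lte_fin ltr_pM2r ?invr_gt0// ltrDl ltr01.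
  by rewrite -EFinB -mulrBl addrAC subrr add0r mul1r.
have kQ : (k.+1 <= Q)%N by have := ltn_ord k; rewrite [X in (_ < X)%N]Zp_cast.
apply/seteqP; split => a.
  rewrite circle_cellE//= => -[+ a01]; rewrite circle_fracP.
  rewrite (_ : Num.floor a = 0) ?subr0//; apply: floor_def.
  by move: a01; rewrite in_itv.
move=> h; have a01 : 0 <= a < 1.
  move: h; rewrite /= in_itv/= => /andP[h1 h2]; apply/andP; split.
    by apply: le_trans h1; rewrite divr_ge0.
  by apply: lt_le_trans h2 _; rewrite ler_pdivrMr// mul1r natr1 ler_nat.
split; last by rewrite /= in_itv.
rewrite circle_cellE//= circle_fracP (_ : Num.floor a = 0) ?subr0//.
exact: floor_def.
Qed.

Lemma centered_sum0 (R : realType) (d Q : nat) (Phi : 'Z_Q -> 'rV[R]_d) :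
  (1 < Q)%N -> centered (step_function Phi) -> \sum_k Phi k = 0.
Proof.
move=> Q1 c; apply/rowP => i; rewrite summxE [RHS]mxE.
have QR : 0 < Q%:R :> R by rewrite ltr0n ltnW.
have := c i.
rewrite (eq_integral (fun x : borel (circle R) =>
   \sum_(k : 'Z_Q) ((Phi k 0 i)%:E * (\1_(circle_cell R k) x)%:E))%E); last first.
  move=> x _; rewrite (bigD1 (cell Q (circle_frac x)))//= indicE mem_set//= mule1.
  rewrite big1 ?adde0// => k kx; rewrite indicE memNset ?mule0//=.
  by move=> E; rewrite E eqxx in kx.
have int (k : 'Z_Q) : (@circle_measure R).-integrable setT (fun x => (\1_(circle_cell R k) x)%:E).
  apply/integrableP; split.
    apply/measurable_EFinP; apply: measurable_indic; exact: measurable_circle_cell.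
  rewrite (eq_integral (fun x => (\1_(circle_cell R k) x)%:E)); last first.
    by move=> x _; rewrite gee0_abs// lee_fin.
  rewrite integral_indic//; last exact: measurable_circle_cell.
  by rewrite setIT [X in (X < _)%E](circle_measure_cell R k Q1) ltry.
rewrite integral_sum//; last by move=> k; exact: integrableZl.
rewrite (eq_bigr (fun k => (Phi k 0 i * Q%:R^-1)%:E)); last first.
  move=> k _; rewrite integralZl// integral_indic//; last exact: measurable_circle_cell.
  by rewrite setIT [X in (_ * X)%E](circle_measure_cell R k Q1) -EFinM.
rewrite sumEFin -mulr_suml => /eqP; rewrite eqe mulf_eq0 invr_eq0 [Q%:R == 0]gt_eqF// orbF.
by move/eqP.
Qed.

(** The null set in [[0, 1)] is repeated by the countably many integer translations. *)
Lemma ae_circle_to_real (R : realType) (P : circle R -> Prop) :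
  {ae @circle_measure R, forall x, P x} ->
  {ae @lebesgue_measure R, forall a, P (to_circle a)}.
Proof.
move=> [N [mN N0 sub]].
have N0' : {ae @lebesgue_measure R, forall a, ~ ((@to_circle R @^-1` N) `&` `[0, 1[%classic) a}.
  exists ((@to_circle R @^-1` N) `&` `[0, 1[%classic); split => //.
  - by apply: measurableI => //; exact: measurable_circle_preimage.
  - by move=> a /= /contrapT.
apply: ae_real_imp (ae_real_forall (fun n : int => ae_shift n%:~R N0')) => a H.
apply: contrapT => Pa; apply: (H (- Num.floor a)).
split; last first.
  by rewrite /= in_itv/= mulrNz subr_ge0 floor_le/= ltrBlDl; have := floorD1_gt a; rewrite intrD.
by rewrite /= to_circleDz; exact: sub.
Qed.

Lemma ae_real_to_circle (R : realType) (P : set (borel (circle R))) :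
  measurable P ->
  {ae @lebesgue_measure R, forall a, P (to_circle a)} ->
  {ae @circle_measure R, forall x, P x}.
Proof.
move=> mP [N [mN N0 sub]].
exists (~` P); split => //; first exact: measurableC.
rewrite circle_measureE; apply/eqP; rewrite -measure_le0 -N0.
apply: le_measure; rewrite ?inE//.
  apply: measurableI => //; apply: measurable_circle_preimage; exact: measurableC.
by move=> a [Pa _]; exact: sub.
Qed.

Lemma measurable_circle_rotation (R : realType) (alpha : R) :
  measurable_fun setT
    ((fun x : circle R => x + to_circle alpha) : borel (circle R) -> borel (circle R)).
Proof.
apply: (@measurability _ _ (borel (circle R)) (borel (circle R)) setT _ (@open (circle R))) => //.
move=> _ [U oU <-]; rewrite setTI; apply: sub_sigma_algebra; rewrite -circle_open.
move: oU; rewrite -circle_open => oU.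
have -> : @to_circle R @^-1` ((fun x => x + to_circle alpha) @^-1` U) =
   (fun a => a + alpha) @^-1` (@to_circle R @^-1` U).
  by apply/seteqP; split => a /=; rewrite to_circleD.
by apply: open_comp => // x _; apply: continuousD; [exact: cvg_id|exact: cst_continuous].
Qed.

Lemma circle_rotation_integral (R : realType) (alpha : R) (F : borel (circle R) -> \bar R) :
  measurable_fun setT F -> (forall x, 0 <= F x)%E ->
  (\int[@circle_measure R]_x F ((x : circle R) + to_circle alpha)%R = \int[@circle_measure R]_x F x)%E.
Proof.
move=> mF F0; have mr := measurable_circle_rotation alpha.
pose rot := fun x : borel (circle R) => ((x : circle R) + to_circle alpha : borel (circle R)).
transitivity (\int[pushforward (@circle_measure R) rot]_x F x)%E.
  by rewrite (@ge0_integral_pushforward _ _ _ _ R rot mr (@circle_measure R) setT F).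
apply: eq_measure_integral => //= C mC _.
exact: circle_measure_rotation.
Qed.

(** * Boxes in a closed subgroup of Euclidean space *)

Section group.
Variables (R : realType) (d : nat) (S : set 'rV[R]_d).
Local Notation G := (closed_subgroup S).
Implicit Types (y z : G) (l h : 'rV[R]_d).

Lemma subgroup_open (U : set G) : open U ->
  exists2 W : set 'rV[R]_d, open W & U = (fun y : G => \val y) @^-1` W.
Proof.
by move=> [W oW <-]; exists W.
Qed.

Definition coord (i : 'I_d) (y : borel G) : R := (\val (y : G) : 'rV[R]_d) 0 i.

Lemma coordD (i : 'I_d) y z : coord i (y + z) = coord i y + coord i z.
Proof. by rewrite /coord mxE. Qed.

Lemma coordN (i : 'I_d) y : coord i (- y) = - coord i y.
Proof. by rewrite /coord mxE. Qed.

Lemma measurable_coord (i : 'I_d) : measurable_fun setT (coord i).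
Proof.
apply: (measurability _ (RGenOpens.measurableE R)) => //.
move=> _ [_ [a [b ->]] <-]; rewrite setTI; apply: sub_sigma_algebra.
exists [set v : 'rV[R]_d | v 0 i \in `]a, b[] => //.
rewrite (_ : [set v | _] = (fun v : 'rV[R]_d => v 0 i) @^-1` `]a, b[%classic)//.
by apply: open_comp => [v _|]; [exact: coord_continuous|exact: interval_open].
Qed.

Definition box l h : set (borel G) :=
  [set y | forall i, l 0 i <= coord i y <= h 0 i].

Definition boxes : set (set (borel G)) := [set B | exists l h, B = box l h].

Lemma measurable_box l h : measurable (box l h).
Proof.
rewrite (_ : box l h = \bigcap_(i in [set: 'I_d]) (coord i @^-1` `[l 0 i, h 0 i]%classic)).
  apply: fin_bigcap_measurable; first exact: finite_finset.
  by move=> i _; rewrite -[X in measurable X]setTI; exact: measurable_coord.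
by apply/seteqP; split => y /= H i //=; [move=> _; rewrite in_itv/=; exact: H|have := H i Logic.I; rewrite /= in_itv].
Qed.

Lemma setI_closed_boxes : setI_closed boxes.
Proof.
move=> _ _ [l1 [h1 ->]] [l2 [h2 ->]].
exists (\row_i Num.max (l1 0 i) (l2 0 i)), (\row_i Num.min (h1 0 i) (h2 0 i)).
apply/seteqP; split => y /=.
  by move=> [H1 H2] i; rewrite !mxE ge_max le_min; have /andP[-> ->] := H1 i; have /andP[-> ->] := H2 i.
by move=> H; split => i; have := H i; rewrite !mxE ge_max le_min => /andP[/andP[a b] /andP[c e]]; apply/andP.
Qed.

(** An open set of the subgroup is the union of the boxes with rational corners that
    it contains. With stability under intersection, this lets boxes determine
    measures. *)
Lemma borel_boxesE : @measurable _ (borel G) = <<s boxes >>.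
Proof.
rewrite eqEsubset; split; last first.
  apply: smallest_sub; first exact: sigma_algebra_measurable.
  by move=> _ [l [h ->]]; exact: measurable_box.
apply: smallest_sub; first exact: smallest_sigma_algebra.
move=> U /subgroup_open[W oW ->].
pose I := ({ffun 'I_d -> rat} * {ffun 'I_d -> rat})%type.
pose lo (u : I) : 'rV[R]_d := \row_i ratr (u.1 i).
pose hi (u : I) : 'rV[R]_d := \row_i ratr (u.2 i).
pose F (n : nat) : set (borel G) := if unpickle n is Some u then
  if `[< box (lo u) (hi u) `<=` (fun y : G => \val y) @^-1` W >] then box (lo u) (hi u) else set0 else set0.
rewrite (_ : _ @^-1` _ = \bigcup_n F n).
  apply: sigma_algebra_bigcup => n; rewrite /F.
  case: unpickle => [u|]; last exact: sigma_algebra0.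
  by case: ifP => _; [apply: sub_sigma_algebra; eexists; eexists|exact: sigma_algebra0].
apply/seteqP; split => y; last first.
  by move=> [n _]; rewrite /F; case: unpickle => [u|//]; case: asboolP => // sub /sub.
move=> Wy; have /nbhs_ballP[e /= e0 be] : nbhs (\val (y : G)) W by exact: open_nbhs_nbhs.
have /choice[u Hu] : forall i : 'I_d, exists u : rat * rat,
    (coord i y - e < ratr u.1 < coord i y) && (coord i y < ratr u.2 < coord i y + e).
  move=> i.
  have [|q1] := @rat_in_itvoo R (coord i y - e) (coord i y); first by rewrite ltrBlDr ltrDl.
  have [|q2] := @rat_in_itvoo R (coord i y) (coord i y + e); first by rewrite ltrDl.
  by rewrite !in_itv/= => h2 h1; exists (q1, q2); rewrite h1 h2.
pose v : I := ([ffun i => (u i).1], [ffun i => (u i).2]).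
exists (pickle v) => //; rewrite /F pickleK; case: asboolP => [_ i|[]].
  by rewrite !mxE !ffunE; have /andP[/andP[_ h1] /andP[h2 _]] := Hu i; rewrite !ltW.
move=> z zv /=; apply: be; split => // i j; rewrite (ord1 i) {i}.
have := zv j; rewrite !mxE !ffunE => /andP[z1 z2].
have /andP[/andP[h1 h2] /andP[h3 h4]] := Hu j.
rewrite /ball/= -/(coord j y) -/(coord j z) ltr_norml; apply/andP; split; lra.
Qed.

Lemma compact_box l h : compact (box l h : set G).
Proof.
have cK : compact ([set v : 'rV[R]_d | forall i, v 0 i \in `[l 0 i, h 0 i]] `&` closure (subgroup_gen S)).
  apply: compact_closedI; last exact: closed_closure.
  exact: (@rV_compact _ _ (fun i => `[l 0 i, h 0 i]%classic) (fun i => @segment_compact _ _ _)).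
move=> F PF FB.
have FK : ((fun y : G => \val y) @ F) ([set v : 'rV[R]_d | forall i, v 0 i \in `[l 0 i, h 0 i]] `&` closure (subgroup_gen S)).
  apply: (@filterS _ F _ (box l h : set G)) FB => y By /=; split; last exact: set_mem (valP y).
  by move=> i; rewrite in_itv; exact: By.
have [v [[vB vS] clv]] := cK _ _ FK.
pose y : G := exist _ v (mem_set vS).
exists y; split; first by move=> i; have := vB i; rewrite in_itv.
move=> A B FA; rewrite nbhsE => -[U [/subgroup_open[W oW UE] Uy] UB].
have Wv : nbhs v W by apply: open_nbhs_nbhs; split => //; move: Uy; rewrite UE.
have FA' : ((fun y : G => \val y) @ F) ((fun y : G => \val y) @` A).
  by apply: (@filterS _ F _ A) FA => z Az; exists z.
have [w [[z Az zw] Ww]] := clv _ _ FA' Wv.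
by exists z; split => //; apply: UB; rewrite UE/= zw.
Qed.

Lemma measurable_subgroup_fun dT (T : measurableType dT) (f : T -> borel G) :
  (forall i, measurable_fun setT (fun t => coord i (f t))) -> measurable_fun setT f.
Proof.
move=> mf; apply: (measurability _ borel_boxesE) => //.
move=> _ [_ [l [h ->]] <-]; rewrite setTI.
rewrite (_ : f @^-1` box l h = \bigcap_(i in [set: 'I_d]) ((fun t => coord i (f t)) @^-1` `[l 0 i, h 0 i]%classic)).
  apply: fin_bigcap_measurable; first exact: finite_finset.
  by move=> i _; rewrite -[X in measurable X]setTI; exact: mf.
by apply/seteqP; split => t /= H i //=; [move=> _; rewrite in_itv/=; exact: H|have := H i Logic.I; rewrite /= in_itv].
Qed.

Lemma box_exhaustion : [set: borel G] = \bigcup_n box (const_mx (- n%:R)) (const_mx n%:R).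
Proof.
apply/seteqP; split => // y _.
exists (\max_(i : 'I_d) (Num.truncn `|coord i y|).+1)%N => // i.
rewrite !mxE -ler_norml (le_trans (ltW (truncnS_gt _)))// ler_nat.
exact: (@leq_bigmax _ (fun i => (Num.truncn `|coord i y|).+1)).
Qed.

Lemma box_translate l h (z : G) :
  (fun y : G => y + z) @^-1` box l h = box (l - \val z) (h - \val z).
Proof.
by apply/seteqP; split => y /= H i; have := H i; rewrite coordD /coord !mxE lerBlDr lerBrDr.
Qed.

(** The image of [H] is a subgroup that contains [S], hence all of the subgroup whose
    closure [z] belongs to. *)
Lemma subgroup_dense (z : G) (H : set G) (e : R) : zmod_closed [in H] -> 0 < e ->
  (forall v (Sv : S v), H (exist _ v (closed_subgroup_gen Sv))) ->
  exists2 y, H y & forall i, `|coord i z - coord i y| < e.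
Proof.
move=> Hcl e0 HS.
have := set_mem (valP z); move=> /(_ (ball (\val z) e)) [].
  exact: nbhsx_ballx.
move=> v [gv [_ bv]].
have : ((fun y : G => \val y) @` H) v.
  apply: gv; split.
    case: Hcl => H0 HB; split; first by apply/mem_set; exists 0 => //; exact: set_mem.
    move=> _ _ /set_mem[a Ha <-] /set_mem[b Hb <-]; apply/mem_set.
    by exists (a - b) => //; apply/set_mem/HB; apply/mem_set.
  by move=> w Sw; exists (exist _ w (closed_subgroup_gen Sw)).
move=> [y Hy yv]; exists y => // i.
have := bv 0 i; rewrite /ball/= -yv; exact.
Qed.
End group.

(** * Translation invariant measures *)

Section haar.
Variables (R : realType) (d : nat) (S : set 'rV[R]_d).
Local Notation G := (closed_subgroup S).

Definition translation_invariant (mu : set (borel G) -> \bar R) :=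
  forall (z : G) (A : set (borel G)), measurable A -> mu [set y : G | A (z + y)] = mu A.

Lemma measurable_subgroup_add :
  measurable_fun setT (fun u : borel G * borel G => ((u.1 : G) + (u.2 : G) : borel G)).
Proof.
apply: measurable_subgroup_fun => i.
rewrite (_ : (fun _ => _) = (fun u : borel G * borel G => coord i u.1 + coord i u.2)).
  apply: measurable_funD; apply: measurableT_comp => //; exact: measurable_coord.
by apply/funext => u; rewrite coordD.
Qed.

Lemma measurable_subgroup_opp :
  measurable_fun setT (fun y : borel G => (- (y : G) : borel G)).
Proof.
apply: measurable_subgroup_fun => i.
rewrite (_ : (fun _ => _) = (fun y : borel G => - coord i y)).
  apply: measurableT_comp => //; exact: measurable_coord.
by apply/funext => y; rewrite coordN.
Qed.

Lemma measurable_subgroup_translate (z : G) :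
  measurable_fun setT (fun y : borel G => (z + (y : G) : borel G)).
Proof.
apply: measurable_subgroup_fun => i.
rewrite (_ : (fun _ => _) = (fun y : borel G => coord i z + coord i y)).
  apply: measurable_funD => //; exact: measurable_coord.
by apply/funext => y; rewrite coordD.
Qed.

Lemma product_swap dx dy (X : measurableType dx) (Y : measurableType dy)
  (m : {sigma_finite_measure set X -> \bar R}) (c : {sigma_finite_measure set Y -> \bar R})
  (E : set (X * Y)) : measurable E ->
  (\int[m]_x c (xsection E x) = \int[c]_y m (ysection E y))%E.
Proof.
move=> mE.
transitivity ((m \x c)%E E) => //; transitivity ((m \x^ c)%E E) => //.
by apply: product_measure_unique => //= ? ? ? ?; rewrite product_measure2E.
Qed.

(** Weil's computation for the uniqueness of Haar measure. The set [E] of the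
    [(x, y)] with [x] in [C] and [x + y] in [B] has measure [c C * m B] by invariance
    of [m]; translating its horizontal slices, and then its vertical ones, turns it
    into the product of [B] and [- C]. *)
Lemma invariant_measures_swap (m c : {sigma_finite_measure set (borel G) -> \bar R}) :
  translation_invariant m -> translation_invariant c ->
  forall B C : set (borel G), measurable B -> measurable C ->
  (c C * m B = c B * m [set y : G | C (- y)%R])%E.
Proof.
move=> im ic B C mB mC.
pose E : set (borel G * borel G) := [set u | C u.1 /\ B ((u.2 : G) + u.1)].
pose E' : set (borel G * borel G) := [set u | C ((u.1 : G) - u.2) /\ B u.1].
have madd := measurable_subgroup_add; have mopp := measurable_subgroup_opp.
have mE : measurable E.
  apply: measurableI.
    by rewrite -[X in measurable X]setTI; exact: measurable_fst.
  rewrite -[X in measurable X]setTI.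
  have mf : measurable_fun setT (fun u : borel G * borel G => ((u.2 : G) + (u.1 : G) : borel G)).
    rewrite (_ : (fun _ => _) = (fun u : borel G * borel G => ((u.1 : G) + (u.2 : G) : borel G)))//.
    by apply/funext => u; rewrite addrC.
  exact: mf.
have mE' : measurable E'.
  apply: measurableI; last first.
    by rewrite -[X in measurable X]setTI; exact: measurable_fst.
  rewrite -[X in measurable X]setTI.
  have mf : measurable_fun setT (fun u : borel G * borel G => ((u.1 : G) - (u.2 : G) : borel G)).
    apply: measurable_subgroup_fun => i.
    rewrite (_ : (fun _ => _) = (fun u : borel G * borel G => coord i u.1 - coord i u.2)).
      apply: measurable_funB; apply: measurableT_comp => //; exact: measurable_coord.
    by apply/funext => u; rewrite coordD coordN.
  exact: mf.
have mC' : measurable ([set y : G | C (- y)%R] : set (borel G)).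
  by rewrite -[X in measurable X]setTI; exact: mopp.
transitivity (\int[c]_z m (xsection E z))%E.
  rewrite -(product_measure1E c m mC mB); apply: eq_integral => z _ /=.
  have [zC|zC] := boolP (z \in C); last first.
    rewrite notin_xsectionX// (_ : xsection E z = set0)//.
    by rewrite -subset0 => y; rewrite /xsection/= inE => -[/= /mem_set]; rewrite (negbTE zC).
  rewrite in_xsectionX// -(im z)//; congr (m _); apply/seteqP; split => y; rewrite /xsection/= inE /E/=.
    by rewrite addrC => ?; split => //; exact: set_mem.
  by rewrite addrC => -[].
rewrite product_swap//.
transitivity (\int[m]_y c (ysection E' y))%E.
  apply: eq_integral => y _.
  rewrite -(ic y); last exact: measurable_ysection.
  congr (c _); apply/seteqP; split => z; rewrite /ysection/= !inE /E /E'/= addrAC subrr add0r//.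
rewrite -product_swap//.
rewrite -(product_measure1E c m mB mC'); apply: eq_integral => z _ /=.
have [zB|zB] := boolP (z \in B); last first.
  rewrite notin_xsectionX// (_ : xsection E' z = set0)//.
  by rewrite -subset0 => y; rewrite /xsection/= inE => -[/= _ /mem_set]; rewrite (negbTE zB).
rewrite in_xsectionX// -(im (- z) [set y : G | C (- y)%R])//; congr (m _).
apply/seteqP; split => y; rewrite /xsection/= inE /E'/= opprD opprK.
  by case.
by move=> ?; split => //; exact: set_mem.
Qed.

Lemma invariant_measures_proportional (m c : {sigma_finite_measure set (borel G) -> \bar R}) :
  translation_invariant m -> translation_invariant c ->
  forall B C : set (borel G), measurable B -> measurable C -> (0 < m B < +oo)%E ->
  (c C * m B = c B * m C)%E.
Proof.
move=> im ic B C mB mC /andP[B0 Boo].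
rewrite (invariant_measures_swap im ic mB mC); congr (_ * _)%E.
have E := invariant_measures_swap im im mB mC; rewrite muleC in E.
have mBn : m B = (fine (m B))%:E by rewrite fineK// ge0_fin_numE.
have mB0 : fine (m B) != 0 by rewrite gt_eqF// fine_gt0// B0.
have /(congr1 (mule ((fine (m B))^-1)%:E)) := E.
by rewrite mBn !muleA -!EFinM mulVf// !mul1e => ->.
Qed.

Lemma translate_box (z : G) (l h : 'rV[R]_d) :
  (fun y : G => z + y) @^-1` box l h = box (S := S) (l - \val z) (h - \val z).
Proof. by rewrite -box_translate; apply/seteqP; split => y /=; rewrite addrC. Qed.

(** By density [z] is approximated by [y] in [H], and the box translated by [z] is the
    decreasing limit of slightly larger boxes that contain the box translated by [y].
    This bounds the measure of a box by that of its translates, in both directions;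
    finiteness on boxes gives continuity from above. *)
Lemma dense_translation_invariant (c : {measure set (borel G) -> \bar R}) (H : set G) :
  (forall l h, (c (box l h) < +oo)%E) ->
  (forall (z : G) (e : R), 0 < e ->
     exists2 y : G, H y & forall i, `|coord i z - coord i y| < e) ->
  (forall y : G, H y -> forall l h, c ((fun x : G => y + x) @^-1` box l h) = c (box l h)) ->
  translation_invariant c.
Proof.
move=> cfin dense inv.
have step (z : G) (l h : 'rV[R]_d) : (c (box l h) <= c (box (l - \val z)%R (h - \val z)%R))%E.
  pose K n : set (borel G) := box (l - \val z - const_mx n.+1%:R^-1)%R (h - \val z + const_mx n.+1%:R^-1)%R.
  have cap : box (l - \val z) (h - \val z) = \bigcap_n K n.
    apply/seteqP; split => y H1.
      move=> n _ i; have /andP[a b] := H1 i; rewrite !mxE.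
      have n0 : 0 <= n.+1%:R^-1 :> R by rewrite invr_ge0.
      by move: a b; rewrite !mxE => a b; rewrite (le_trans _ a) ?gerBl// (le_trans b)// lerDl.
    move=> i; apply/andP; split; apply/ler_addgt0Pr => e e0;
      have := H1 (Num.truncn e^-1) Logic.I i; rewrite !mxE => /andP[a b];
      have ne : (Num.truncn e^-1).+1%:R^-1 <= e by
        rewrite -[leRHS]invrK lef_pV2 ?posrE ?invr_gt0// ltW// truncnS_gt.
    - by move: (coord i y) (l 0 i) (\val z 0 i) (_.+1%:R^-1) a ne => cy li zi n a ne; lra.
    - by move: (coord i y) (h 0 i) (\val z 0 i) (_.+1%:R^-1) b ne => cy hi zi n b ne; lra.
  have mK n : measurable (K n) by exact: measurable_box.
  have noninc : nonincreasing_seq K.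
    move=> n1 n2 n12; apply/subsetPset => y H1 i; have := H1 i; rewrite !mxE.
    have : n2.+1%:R^-1 <= n1.+1%:R^-1 :> R by rewrite lef_pV2 ?posrE// ler_nat.
    by move: (coord i y) (l 0 i) (h 0 i) (\val z 0 i) (n1.+1%:R^-1) (n2.+1%:R^-1) => cy li hi zi r1 r2 ? /andP[a b]; apply/andP; split; lra.
  rewrite cap.
  have cv := nonincreasing_cvg_mu (mu := c) (cfin _ _) mK (bigcap_measurableType (fun n _ => mK n)) noninc.
  rewrite -(cvg_lim _ cv)//; apply: lime_ge; first by apply/cvg_ex; eexists; exact: cv.
  apply: nearW => n /=.
  have n0 : 0 < n.+1%:R^-1 :> R by rewrite invr_gt0.
  have [y Hy yz] := dense z _ n0.
  rewrite -(inv y Hy) translate_box; apply: le_measure; rewrite ?inE//; try exact: measurable_box.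
  move=> x H1 i; have := H1 i; have := yz i; rewrite !mxE ltr_norml /coord => /andP[u v] /andP[a b].
  move: (\val x 0 i) (\val y 0 i) (l 0 i) (h 0 i) (\val z 0 i) (n.+1%:R^-1) u v a b => cx cy li hi zi r u v a b.
  by apply/andP; split; lra.
move=> z A mA.
have mt := measurable_subgroup_translate z.
pose t : {mfun borel G >-> borel G} := HB.pack (fun y : borel G => (z + (y : G) : borel G)) (isMeasurableFun.Build _ _ _ _ _ mt).
transitivity (pushforward c t A) => //.
apply/esym; apply: (measure_unique (@boxes R d S) (fun n => box (const_mx (- n%:R)) (const_mx n%:R))) => //.
- exact: borel_boxesE.
- exact: setI_closed_boxes.
- by move=> n; eexists; eexists.
- exact/esym/box_exhaustion.
- move=> _ [l [h ->]]; transitivity (c (box (l - \val z) (h - \val z))); last by rewrite -translate_box.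
  apply/eqP; rewrite eq_le step/=.
  have := step (- z) (l - \val z) (h - \val z).
  by rewrite (_ : \val (- z) = - \val z)// !opprK !subrK.
Qed.

Lemma sigma_finite_boxes (c : {measure set (borel G) -> \bar R}) :
  (forall l h, (c (box l h) < +oo)%E) -> sigma_finite setT c.
Proof.
move=> cfin; exists (fun n => box (const_mx (- n%:R)) (const_mx n%:R)); first exact: box_exhaustion.
by move=> n; split => //; exact: measurable_box.
Qed.

Lemma haar_box_finite (m : set (borel G) -> \bar R) (l h : 'rV[R]_d) :
  haar_measure (G := G) m -> (m (box l h) < +oo)%E.
Proof. by move=> [_ + _ _]; apply; exact: compact_box. Qed.

Lemma haar_translation_invariant (m : set (borel G) -> \bar R) :
  haar_measure (G := G) m -> translation_invariant m.
Proof. by move=> [inv _ _ _] z A mA; apply: inv. Qed.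

Lemma positive_box (m : {measure set (borel G) -> \bar R}) : (0 < m setT)%E ->
  exists l h, (0 < m (box l h))%E.
Proof.
move=> m0; apply: contrapT => H; move: m0; rewrite lt0e => /andP[/eqP + _]; apply.
rewrite box_exhaustion.
have : m.-negligible (\bigcup_n (box (S := S) (const_mx (- n%:R)) (const_mx n%:R))).
  apply: negligible_bigcup => n; apply/negligibleP; first exact: measurable_box.
  apply/eqP; rewrite -measure_le0 leNgt; apply/negP => h; apply: H.
  by exists (const_mx (- n%:R)), (const_mx n%:R).
apply: measure_negligible; apply: bigcupT_measurable => n; exact: measurable_box.
Qed.
End haar.

(** * The skew product: invariance and conservativity *)

Lemma measure_preserving_iter dX (X : measurableType dX) (R : realType)
    (mu : set X -> \bar R) (T : X -> X) (n : nat) (A : set X) :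
  measure_preserving mu T -> measurable A ->
  measurable (iter n T @^-1` A) /\ mu (iter n T @^-1` A) = mu A.
Proof.
move=> [mT pT] mA; elim: n => [|n [mn En]]; first by [].
have -> : iter n.+1 T @^-1` A = T @^-1` (iter n T @^-1` A).
  by apply/funext => z; rewrite /preimage/= -iterS iterSr.
by split; [rewrite -[X in measurable X]setTI; exact: mT|rewrite pT].
Qed.

(** Infinitely many of the disjoint sets [T^-n V], all of the measure of [V], lie in a
    set of finite measure. *)
Lemma wandering_null dX (X : measurableType dX) (R : realType)
    (mu : {measure set X -> \bar R}) (T : X -> X) (V K : set X) :
  measure_preserving mu T -> measurable V -> wandering T V ->
  measurable K -> (mu K < +oo)%E ->
  (forall N, exists2 n, (N <= n)%N & iter n T @^-1` V `<=` K) -> mu V = 0%E.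
Proof.
move=> pT mV wV mK Koo H.
have /choice[f Hf] : forall N, exists n, (N < n)%N /\ iter n T @^-1` V `<=` K.
  by move=> N; have [n Nn sub] := H N.+1; exists n.
pose s i := iter i f (f 0%N).
have sK i : iter (s i) T @^-1` V `<=` K by case: i => [|i]; [have [] := Hf 0%N|have [] := Hf (s i)].
have ss : {homo s : i j / (i < j)%N}.
  by apply: homo_ltn => [i j k|i]; [exact: ltn_trans|have [] := Hf (s i)].
pose F i := iter (s i) T @^-1` V.
have mF i : measurable (F i) by have [] := measure_preserving_iter (s i) pT mV.
have tF : trivIset setT F.
  move=> i j _ _ FF; apply: contrapT => /eqP; rewrite neq_ltn => ij.
  have : s i = s j by apply: (wV (s i) (s j)).
  by move: ij => /orP[] /ss; lia.
have bound n : (\sum_(i < n) mu V <= mu K)%E.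
  have -> : (\sum_(i < n) mu V = mu (\big[setU/set0]_(i < n) F i))%E.
    rewrite measure_bigsetU//; apply: eq_bigr => i _; apply/esym.
    by have [] := measure_preserving_iter (s i) pT mV.
  apply: le_measure; rewrite ?inE//; first exact: bigsetU_measurable.
  by rewrite -bigcup_mkord => x [i _]; exact: sK.
have Kfin : mu K \is a fin_num by rewrite ge0_fin_numE.
have Vfin : mu V \is a fin_num.
  by rewrite ge0_fin_numE// (le_lt_trans _ Koo)// (le_trans _ (bound 1%N))// big_ord1.
apply/eqP; rewrite -(fineK Vfin) eqe; apply/negPn/negP => V0.
have {}V0 : 0 < fine (mu V) by rewrite lt_def V0 fine_ge0.
have := bound (Num.truncn (fine (mu K) / fine (mu V))).+1.
rewrite -(fineK Vfin) -(fineK Kfin) sumEFin lee_fin sumr_const card_ord leNgt => /negP; apply.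
by rewrite -[ltRHS]mulr_natl -ltr_pdivrMr// truncnS_gt.
Qed.

Section skew.
Variables (R : realType) (d Q : nat) (hQ : (1 < Q)%N) (Phi : 'Z_Q -> 'rV[R]_d).
Local Notation phi := (@step_function R _ Q Phi).
Local Notation G := (closed_subgroup (range phi)).

Definition step_value (k : 'Z_Q) : G := corestrict phi (to_circle (k%:R / Q%:R)).

Lemma val_step_value (k : 'Z_Q) : \val (step_value k) = Phi k.
Proof.
rewrite /= step_functionE//; congr Phi.
have := @cell_int_shift R Q k 0 hQ; rewrite addr0 lexx; apply.
by rewrite normr0 invr_gt0 ltr0n ltnW.
Qed.

Lemma corestrict_stepE (x : circle R) : corestrict phi x = step_value (cell Q (circle_frac x)).
Proof. by apply: val_inj; rewrite val_step_value. Qed.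

Lemma corestrict_step_to_circle (a : R) : corestrict phi (to_circle a) = step_value (cell Q a).
Proof. by apply: val_inj; rewrite val_step_value /= step_functionE. Qed.

(** The homomorphism from the free abelian group on the cells to [Gamma] that turns the
    lifted Birkhoff sums into those of the step function. *)
Definition combination (v : {ffun 'Z_Q -> int}) : G := \sum_k step_value k *~ v k.

Lemma combinationD u v : combination (u + v) = combination u + combination v.
Proof. by rewrite /combination -big_split/=; apply: eq_bigr => k _; rewrite ffunE mulrzDr. Qed.

Lemma combinationN u : combination (- u) = - combination u.
Proof. by rewrite /combination -sumrN; apply: eq_bigr => k _; rewrite ffunE mulrNz. Qed.

Lemma combination0 : combination 0 = 0.
Proof. by rewrite /combination big1// => k _; rewrite ffunE mulr0z. Qed.

Lemma combination_basis k : combination (basis_vector k) = step_value k.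
Proof.
rewrite /combination (bigD1 k)//= ffunE eqxx mulr1z big1 ?addr0// => l lk.
by rewrite ffunE eq_sym (negbTE lk) mulr0z.
Qed.

Lemma combination_constant z : centered phi -> combination (constant_vector Q z) = 0.
Proof.
move=> /(centered_sum0 hQ) sum0.
rewrite /combination; under eq_bigr do rewrite ffunE.
apply: val_inj.
rewrite (_ : \val (\sum_k step_value k *~ z) = (\sum_k Phi k) *~ z).
  by rewrite sum0 mul0rz.
rewrite raddf_sum mulrz_suml; apply: eq_bigr => k _.
by rewrite raddfMz; congr (_ *~ _); exact: val_step_value.
Qed.

Lemma combination_dense (z : G) (e : R) : 0 < e ->
  exists2 y, range combination y & forall i, `|coord i z - coord i y| < e.
Proof.
move=> e0; apply: subgroup_dense => //.
  split; first by apply/mem_set; exists 0 => //; exact: combination0.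
  move=> _ _ /set_mem[u _ <-] /set_mem[v _ <-]; apply/mem_set.
  by exists (u - v) => //; rewrite combinationD combinationN.
move=> v Sv; have [x _ xv] := Sv; exists (basis_vector (cell Q (circle_frac x))) => //.
by rewrite combination_basis -corestrict_stepE; apply: val_inj.
Qed.

Variable alpha : R.
Local Notation T := (skew_product alpha (corestrict phi)).

Lemma skewE (a : R) (y : G) : T (to_circle a, y) = (to_circle (a + alpha), y + step_value (cell Q a)).
Proof. by rewrite /skew_product/= -to_circleD corestrict_step_to_circle. Qed.

Lemma iter_skewE (n : nat) (a : R) (y : G) :
  iter n T (to_circle a, y) = (to_circle (a + n%:R * alpha), y + combination (birkhoff Q alpha n a)).
Proof.
elim: n => [|n IH]; first by rewrite mul0r /birkhoff big_ord0 combination0 !addr0.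
rewrite iterS IH skewE -addrA -natr1 mulrDl mul1r addrA; congr (_, _).
by rewrite -addrA /birkhoff big_ord_recr/= combinationD combination_basis.
Qed.

Lemma measurable_skew :
  measurable_fun setT (T : borel (circle R) * borel G -> borel (circle R) * borel G).
Proof.
apply: measurable_fun_pair.
  apply: (measurableT_comp (measurable_circle_rotation alpha)); exact: measurable_fst.
apply: measurable_subgroup_fun => i.
rewrite (_ : (fun _ => _) = (fun z : borel (circle R) * borel G => coord i z.2 +
   \sum_(k : 'Z_Q) (Phi k 0 i * \1_(circle_cell R k) z.1))).
  apply: measurable_funD; first by apply: measurableT_comp; [exact: measurable_coord|exact: measurable_snd].
  apply: measurable_sum => k; apply: measurable_funM => //.
  apply: measurableT_comp; last exact: measurable_fst.
  by apply: measurable_indic; exact: measurable_circle_cell.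
apply/funext => -[x y] /=; rewrite coordD; congr (_ + _).
rewrite corestrict_stepE /coord val_step_value.
rewrite (bigD1 (cell Q (circle_frac x)))//= indicE mem_set//= mulr1.
rewrite big1 ?addr0// => k kx; rewrite indicE memNset ?mulr0//=.
by move=> E; rewrite E eqxx in kx.
Qed.

Variable m : {sigma_finite_measure set (borel G) -> \bar R}.
Hypothesis im : translation_invariant m.
Local Notation mu := (@circle_measure R \x m)%E.

Lemma skew_measure_preserving : measure_preserving mu (T : borel (circle R) * borel G -> borel (circle R) * borel G).
Proof.
split; first exact: measurable_skew.
move=> A mA.
rewrite /product_measure1.
transitivity (\int[@circle_measure R]_x (m \o xsection A) ((x : circle R) + to_circle alpha)%R)%E.
  apply: eq_integral => x _ /=.
  rewrite -[RHS](im (corestrict phi x)); last exact: measurable_xsection.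
  by congr (m _); apply/seteqP; split => y; rewrite /xsection/= !inE/= /skew_product/= [_ + y]addrC.
apply: circle_rotation_integral => //; exact: measurable_fun_xsection.
Qed.

Hypothesis mbox : forall l h, (m (box l h) < +oo)%E.

(** Cut the wandering set to height in a box [B]. If [T^q z] lies above [B] then [z]
    lies above a translate of [B] by the sum of order [q]; at good denominators
    only finitely many translates occur. *)
Lemma skew_conservative : centered phi -> SBAD R Q alpha ->
  conservative mu (T : borel (circle R) * borel G -> borel (circle R) * borel G).
Proof.
move=> cphi Salpha W mW wW.
pose B n : set (borel G) := box (const_mx (- n%:R)) (const_mx n%:R).
suff H n : mu (W `&` (setT `*` B n)) = 0%E.
  have : (product_measure1 (@circle_measure R) m).-negligible (\bigcup_n (W `&` (setT `*` B n))).
    apply: negligible_bigcup => n; apply/negligibleP; last exact: H.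
    by apply: measurableI => //; apply: measurableX => //; exact: measurable_box.
  rewrite -setI_bigcupr -setX_bigcupr -box_exhaustion setXTT setIT.
  exact: measure_negligible.
have mV : measurable (W `&` (setT `*` B n)).
  by apply: measurableI => //; apply: measurableX => //; exact: measurable_box.
have [c c0 good] := SBAD_good_denominator (ltnW hQ) Salpha.
(* All positions, for the finitely many codes, from which the sum can lead into
   [B n]. *)
pose K' : set (borel G) := \big[setU/set0]_(v : {ffun 'Z_Q -> 'I_(6 * Q).+1})
   ((fun y : G => y + combination (decode v)) @^-1` B n).
have mK' : measurable K'.
  by apply: bigsetU_measurable => v _; rewrite box_translate; exact: measurable_box.
apply: (wandering_null (K := setT `*` K') skew_measure_preserving mV).
- move=> i j _ _ [x [/= [Wi _] [Wj _]]]; apply: (wW i j) => //.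
  by exists x; split.
- exact: measurableX.
- rewrite [ltLHS](product_measure1E (@circle_measure R) m measurableT mK').
  rewrite [X in (X * _)%E]circle_measureT mul1e.
  suff [_ ->] : measurable K' /\ (m K' < +oo)%E by [].
  rewrite /K'; apply: (big_ind (fun U : set (borel G) => measurable U /\ (m U < +oo)%E)).
  + by rewrite measure0 ltry.
  + move=> U V [mU HU] [mVV HV]; split; first exact: measurableU.
    by rewrite (le_lt_trans (measureU2 _ _ _))// lte_add_pinfty.
  + by move=> v _; rewrite box_translate; split; [exact: measurable_box|exact: mbox].
- move=> N; have [q Nq [p gd]] := good N; exists q => //.
  move=> [x y]; rewrite -(circle_fracK x) /preimage/= => -[_ [_]].
  rewrite iter_skewE/= => By; split => //.
  rewrite /= /K' (bigD1 (code (birkhoff Q alpha q (circle_frac x))))//=; left.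
  have := By; rewrite {1}(birkhoff_codeK (circle_frac x) hQ gd) combinationD.
  by rewrite combination_constant// addr0.
Qed.
End skew.

(** * The skew product: ergodicity *)

(** An alias of [c] that carries a proof of sigma-finiteness into the hierarchy of
    measures. *)
Definition as_sigma_finite dX (X : measurableType dX) (K : realType) (c : {measure set X -> \bar K})
    (sf : sigma_finite setT c) : set X -> \bar K := c.
HB.instance Definition _ dX (X : measurableType dX) (K : realType) (c : {measure set X -> \bar K})
    (sf : sigma_finite setT c) := Measure.copy (as_sigma_finite sf) c.
HB.instance Definition _ dX (X : measurableType dX) (K : realType) (c : {measure set X -> \bar K})
    (sf : sigma_finite setT c) := Measure_isSigmaFinite.Build _ X K (as_sigma_finite sf) sf.

Lemma null_difference_measure dX (X : measurableType dX) (R : realType)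
    (mu : {measure set X -> \bar R}) (U V B : set X) :
  measurable U -> measurable V -> measurable B ->
  mu ((U `\` V) `|` (V `\` U)) = 0%E -> mu (U `&` B) = mu (V `&` B).
Proof.
move=> mU mV mB D0.
have mD : measurable ((U `\` V) `|` (V `\` U)) by apply: measurableU; exact: measurableD.
have le W1 W2 : measurable W1 -> measurable W2 -> W1 `<=` W2 `|` ((U `\` V) `|` (V `\` U)) ->
    (mu W1 <= mu W2)%E.
  move=> m1 m2 sub; rewrite -[leRHS]adde0 -D0.
  apply: le_trans (measureU2 _ m2 mD); apply: le_measure; rewrite ?inE//.
  exact: measurableU.
apply/eqP; rewrite eq_le; apply/andP; split; apply: le; do ?exact: measurableI.
  move=> z [Uz Bz]; have [Vz|Vz] := pselect (V z); first by left.
  by right; left.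
move=> z [Vz Bz]; have [Uz|Uz] := pselect (U z); first by left.
by right; right.
Qed.

Lemma null_sections dX dY (X : measurableType dX) (Y : measurableType dY) (R : realType)
    (m1 : {measure set X -> \bar R}) (m2 : {sigma_finite_measure set Y -> \bar R})
    (D : set (X * Y)) : measurable D -> (m1 \x m2)%E D = 0%E ->
  {ae m1, forall x, m2 (xsection D x) = 0%E}.
Proof.
move=> mD D0.
have [+ _] := ae_eq_integral_abs m1 (@measurableT _ X) (measurable_fun_xsection m2 mD).
have -> : (\int[m1]_x `|(m2 \o xsection D) x| = 0)%E.
  by rewrite -[RHS]D0; apply: eq_integral => x _; rewrite gee0_abs.
by move=> /(_ erefl); apply: filterS => x; apply.
Qed.

(** [circle_measure] as a probability, for the results that need a finite or
    sigma-finite measure. *)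
Definition circle_probability (K : realType) : probability (borel (circle K)) K :=
  HB.pack (@circle_measure K) (@Measure_isProbability.Build _ (borel (circle K)) K (@circle_measure K) (circle_measureT K)).

(** For fixed [C] both sides are measures in the second factor, so agreement on boxes
    extends to all measurable sets, hence to all rectangles. *)
Lemma product_measure_boxes_unique (R : realType) (d : nat) (S : set 'rV[R]_d)
    (c : {sigma_finite_measure set (borel (closed_subgroup S)) -> \bar R})
    (m : {measure set (borel (circle R) * borel (closed_subgroup S)) -> \bar R}) :
  (forall l h, (c (box l h) < +oo)%E) ->
  (forall C l h, measurable C -> m (C `*` box l h) = (circle_measure C * c (box l h))%E) ->
  forall E, measurable E -> m E = (@circle_measure R \x c)%E E.
Proof.
move=> cbox rect E mE; apply/esym.
apply: (@product_measure_unique _ _ _ _ _ (circle_probability R) c m) => // C B mC mB.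
have msnd : measurable_fun setT
    (fun z : borel (circle R) * borel (closed_subgroup S) => z.2 : borel (closed_subgroup S)).
  exact: measurable_snd.
have mCT : measurable (C `*` [set: borel (closed_subgroup S)]) by exact: measurableX.
pose mC' : {measure set (borel (closed_subgroup S)) -> \bar R} :=
  measure_function_pushforward__canonical__measure_function_Measure (mrestr m mCT) msnd.
have mC'E D : mC' D = m (C `*` D).
  rewrite /mC'/= /pushforward /mrestr setIC; congr (m _).
  by apply/seteqP; split => -[x y] /=; [move=> [[? _] ?]|move=> [? ?]].
have Cfin : circle_measure C = (fine (circle_measure C))%:E.
  rewrite fineK// ge0_fin_numE//; apply: le_lt_trans (ltry 1).
  by rewrite -(circle_measureT R) le_measure ?inE.
pose k : {nonneg R} := NngNum (fine_ge0 (measure_ge0 (@circle_measure R) C)).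
transitivity (mscale k c B); last by rewrite [RHS](congr1 (mule^~ (c B)) Cfin).
rewrite -mC'E.
apply: (measure_unique (@boxes R d S) (fun n => box (const_mx (- n%:R)) (const_mx n%:R))) => //.
- exact: borel_boxesE.
- exact: setI_closed_boxes.
- by move=> n; eexists; eexists.
- exact/esym/box_exhaustion.
- move=> _ [l [h ->]]; transitivity ((fine (circle_measure C))%:E * c (box l h))%E => //.
  by rewrite mC'E rect// -Cfin.
- move=> n; rewrite [X in (X < _)%E]mC'E rect// lte_mul_pinfty//.
  by rewrite Cfin.
Qed.

Section ergodicity.
Variables (R : realType) (d Q : nat) (hQ : (1 < Q)%N) (Phi : 'Z_Q -> 'rV[R]_d).
Local Notation phi := (@step_function R _ Q Phi).
Local Notation G := (closed_subgroup (range phi)).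
Variable alpha : R.
Local Notation T := (skew_product alpha (corestrict phi)).
Variable m : {sigma_finite_measure set (borel G) -> \bar R}.
Hypothesis im : translation_invariant m.
Local Notation mu := (@circle_measure R \x m)%E.

(** Above [x], invariance of [A] says that the section over [x + alpha] is, up to a
    null set, the section over [x] translated by the value of the step function. *)
Lemma section_cocycle (A : set (borel (circle R) * borel G)) (B : set (borel G)) :
  measurable A -> measurable B ->
  mu ((T @^-1` A `\` A) `|` (A `\` T @^-1` A)) = 0%E ->
  {ae @lebesgue_measure R, forall a, forall v : {ffun 'Z_Q -> int},
    m (xsection A (to_circle (a + alpha)) `&` [set y : G | B (y + combination Phi v)]) =
    m (xsection A (to_circle a) `&` [set y : G | B (y + combination Phi (v + basis_vector (cell Q a)))])}.
Proof.
move=> mA mB D0.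
have mTA : measurable (T @^-1` A : set (borel (circle R) * borel G)).
  by rewrite -[X in measurable X]setTI; apply: measurable_skew.
have mD : measurable ((T @^-1` A `\` A) `|` (A `\` T @^-1` A) : set (borel (circle R) * borel G)).
  by apply: measurableU; exact: measurableD.
have /ae_circle_to_real := null_sections mD D0.
apply: ae_real_imp => a a0 v.
have mtr z : measurable ([set y : G | B (y + z)] : set (borel G)).
  rewrite (_ : [set _ | _] = [set y : G | B (z + y)]).
    by rewrite -[X in measurable X]setTI; exact: (measurable_subgroup_translate z).
  by apply/seteqP; split => y /=; rewrite addrC.
rewrite -[LHS](im (step_value Phi (cell Q a))); last first.
  by apply: measurableI => //; exact: measurable_xsection.
transitivity (m (xsection (T @^-1` A : set (borel (circle R) * borel G)) (to_circle a) `&` [set y : G | B (y + combination Phi (v + basis_vector (cell Q a)))])).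
  congr (m _); apply/seteqP; split => y; rewrite /= /xsection/= !inE/= skewE//
    combinationD combination_basis => -[h1 h2]; split.
  - by rewrite [y + _]addrC.
  - by move: h2; rewrite [step_value _ _ + y]addrC -addrA [step_value _ _ + _]addrC.
  - by rewrite [_ + y]addrC.
  - by rewrite [step_value _ _ + y]addrC -addrA [step_value _ _ + _]addrC.
apply: null_difference_measure => //; try exact: measurable_xsection.
rewrite -[RHS]a0; congr (m _).
by apply/seteqP; split => y; rewrite /xsection/= !inE.
Qed.

(** The measures of the sections of [A], cut by the translates of [B], form an
    equivariant family. *)
Lemma section_constant (A : set (borel (circle R) * borel G)) (B : set (borel G)) :
  centered phi -> SBAD R Q alpha -> measurable A -> measurable B -> (m B < +oo)%E ->
  mu ((T @^-1` A `\` A) `|` (A `\` T @^-1` A)) = 0%E ->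
  exists kappa : R, forall v : {ffun 'Z_Q -> int}, {ae @circle_measure R, forall x,
    m (xsection A x `&` [set y : G | B (y + combination Phi v)]) = kappa%:E}.
Proof.
move=> cphi Salpha mA mB Boo D0.
pose Bv v : set (borel G) := [set y : G | B (y + combination Phi v)].
have BvE v : Bv v = [set y : G | B (combination Phi v + y)].
  by apply/seteqP; split => y /=; rewrite addrC.
have mBv v : measurable (Bv v).
  by rewrite BvE -[X in measurable X]setTI; exact: (measurable_subgroup_translate (combination Phi v)).
have mAx x : measurable (xsection A x) by exact: measurable_xsection.
have le v x : (m (xsection A x `&` Bv v) <= m B)%E.
  rewrite -(im (combination Phi v) mB) -BvE; apply: le_measure; rewrite ?inE//.
  exact: measurableI.
have fin v x : m (xsection A x `&` Bv v) \is a fin_num.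
  by rewrite ge0_fin_numE// (le_lt_trans (le v x)).
have mf v : measurable_fun setT (fun x : borel (circle R) => m (xsection A x `&` Bv v)).
  rewrite (_ : (fun _ => _) = (m \o xsection (A `&` (setT `*` Bv v)))).
    by apply: measurable_fun_xsection; apply: measurableI => //; exact: measurableX.
  apply/funext => x /=; congr (m _).
  by apply/seteqP; split => y; rewrite /xsection/= !inE/= => -[h]; [|case]; split.
pose g v a := fine (m (xsection A (to_circle a) `&` Bv v)).
have eqv : equivariant_family alpha g (fine (m B)).
  split.
  - move=> v; apply: measurableT_comp => //.
    exact: measurableT_comp (mf v) (@measurable_to_circle R).
  - by move=> v a; rewrite ger0_norm ?fine_ge0// fine_le// ge0_fin_numE.
  - by move=> v a n; rewrite /g to_circleDz.
  - move=> v z a; rewrite /g; congr (fine (m (_ `&` _))).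
    by rewrite /Bv combinationD combination_constant// addr0.
  - apply: ae_real_imp (section_cocycle mA mB D0) => a H v.
    by rewrite /g /Bv H.
have [kappa Hk] := equivariant_constant hQ Salpha eqv.
exists kappa => v.
have mP : measurable [set x : borel (circle R) | m (xsection A x `&` Bv v) = kappa%:E].
  rewrite (_ : [set _ | _] = setT `&` (fun x : borel (circle R) => m (xsection A x `&` Bv v)) @^-1` [set kappa%:E]).
    by apply: mf => //; exact: emeasurable_set1.
  by rewrite setTI.
apply: ae_real_to_circle mP _.
by apply: ae_real_imp Hk => a /(_ v) <-; rewrite /= fineK.
Qed.

Lemma product_sections_constant (A : set (borel (circle R) * borel G)) (B : set (borel G)) (kappa : R) :
  measurable A -> measurable B ->
  {ae @circle_measure R, forall x, m (xsection A x `&` B) = kappa%:E} ->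
  forall C, measurable C -> mu (A `&` (C `*` B)) = (circle_measure C * kappa%:E)%E.
Proof.
move=> mA mB H C mC.
have mACB : measurable (A `&` (C `*` B)) by apply: measurableI => //; exact: measurableX.
have mAx x : measurable (xsection A x) by exact: measurable_xsection.
transitivity (\int[@circle_measure R]_x (kappa%:E * (\1_C x)%:E))%E; last first.
  rewrite integralZl//; first by rewrite integral_indic// setIT muleC.
  exact: (@integrable_indic _ _ _ (circle_probability R)).
apply: ae_eq_integral => //; first exact: measurable_fun_xsection.
  by apply: measurable_funeM; apply/measurable_EFinP; exact: measurable_indic.
apply: filterS H => x Hx _ /=.
rewrite indicE; have [xC|xC] := boolP (x \in C).
  rewrite mule1 -Hx; congr (m _); apply/seteqP; split => y; rewrite /xsection/= !inE/=.
    by move=> [h [_ b]].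
  by move=> [h b]; split => //; split => //; exact: set_mem.
rewrite mule0 (_ : xsection _ _ = set0) ?measure0//.
by rewrite -subset0 => y; rewrite /xsection/= inE => -[_ [/mem_set]]; rewrite (negbTE xC).
Qed.

Hypothesis mbox : forall l h, (m (box l h) < +oo)%E.

Lemma invariant_set_boxes (A : set (borel (circle R) * borel G)) (l h : 'rV[R]_d) :
  centered phi -> SBAD R Q alpha -> measurable A ->
  mu ((T @^-1` A `\` A) `|` (A `\` T @^-1` A)) = 0%E ->
  exists kappa : R, forall C (v : {ffun 'Z_Q -> int}), measurable C ->
    mu (A `&` (C `*` ((fun y : G => combination Phi v + y) @^-1` box l h))) =
    (circle_measure C * kappa%:E)%E.
Proof.
move=> cphi Salpha mA D0.
have [kappa H] := section_constant cphi Salpha mA (measurable_box l h) (mbox l h) D0.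
exists kappa => C v mC.
rewrite (_ : _ @^-1` _ = [set y : G | box l h (y + combination Phi v)]); last first.
  by apply/seteqP; split => y /=; rewrite addrC.
apply: (product_sections_constant mA) (H v) _ mC.
rewrite -[X in measurable X]/((fun y : G => y + combination Phi v) @^-1` box l h).
by rewrite box_translate; exact: measurable_box.
Qed.

(** The measure [c0] of heights in [A] is proportional to [m], with factor [lam]; then
    [A] is independent of every set [E] in the sense that [mu (A & E) = lam * mu E]. *)
Lemma skew_ergodic : (0 < m setT)%E -> centered phi -> SBAD R Q alpha ->
  ergodic mu (T : borel (circle R) * borel G -> borel (circle R) * borel G).
Proof.
move=> m0 cphi Salpha A mA D0.
have msnd : measurable_fun setT (fun z : borel (circle R) * borel G => z.2 : borel G).
  exact: measurable_snd.
pose c0 : {measure set (borel G) -> \bar R} :=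
  measure_function_pushforward__canonical__measure_function_Measure (mrestr mu mA) msnd.
have c0E B : c0 B = mu (A `&` (setT `*` B)).
  rewrite /c0/= /pushforward /mrestr setIC; congr (mu (_ `&` _)).
  by apply/seteqP; split => z //=; case.
have boxP l h C v : measurable C ->
    mu (A `&` (C `*` ((fun y : G => combination Phi v + y) @^-1` box l h))) =
    (circle_measure C * c0 (box l h))%E /\ (c0 (box l h) < +oo)%E.
  move=> mC; have [kappa H] := invariant_set_boxes l h cphi Salpha mA D0.
  suff -> : c0 (box l h) = kappa%:E by split; [exact: H|exact: ltry].
  have := H setT 0 measurableT; rewrite [X in (X * _)%E]circle_measureT mul1e => <-.
  rewrite c0E combination0; congr (mu (_ `&` (_ `*` _))).
  by apply/seteqP; split => y /=; rewrite add0r.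
have c0box l h : (c0 (box l h) < +oo)%E by have [] := boxP l h setT 0 measurableT.
pose c := as_sigma_finite (sigma_finite_boxes c0box).
have ic : translation_invariant c.
  apply: (dense_translation_invariant (c := c0) c0box (combination_dense hQ (Phi := Phi))).
  move=> _ [v _ <-] l h; rewrite [LHS]c0E; have [-> _] := boxP l h setT v measurableT.
  by rewrite [X in (X * _)%E]circle_measureT mul1e.
have [l0 [h0 B0]] := positive_box m0.
have B0fin : m (box l0 h0) \is a fin_num by rewrite ge0_fin_numE.
have c0fin : c0 (box l0 h0) \is a fin_num by rewrite ge0_fin_numE.
have B0' : 0 < fine (m (box l0 h0)) by rewrite fine_gt0// B0/= mbox.
pose lam := fine (c0 (box l0 h0)) / fine (m (box l0 h0)).
have lam0 : 0 <= lam by rewrite divr_ge0// fine_ge0.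
(* The box only serves to fix the factor between the two measures. *)
have cE C : measurable C -> c0 C = (lam%:E * m C)%E.
  move=> mC; have : (0 < m (box l0 h0) < +oo)%E by rewrite B0 mbox.
  move=> /(invariant_measures_proportional im ic (measurable_box l0 h0) mC) H.
  have : (c0 C * m (box l0 h0) = c0 (box l0 h0) * m C)%E by exact: H.
  rewrite -(fineK B0fin) -(fineK c0fin) => /(congr1 (fun u => u * (fine (m (box l0 h0)))^-1%:E)%E).
  rewrite -muleA -EFinM divff ?gt_eqF// mule1 => ->.
  by rewrite muleAC -EFinM.
have key E : measurable E -> mu (A `&` E) = (lam%:E * mu E)%E.
  move=> mE; rewrite -ge0_integralZl//; last exact: measurable_fun_xsection.
  transitivity ((@circle_measure R \x c)%E E); last first.
    by apply: eq_integral => x _; apply: cE; exact: measurable_xsection.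
  rewrite setIC; apply: (product_measure_boxes_unique (c := c) (m := mrestr mu mA)) => // C l h mC.
  rewrite /= /mrestr setIC; have [+ _] := boxP l h C 0 mC.
  rewrite combination0 (_ : _ @^-1` _ = box l h)//.
  by apply/seteqP; split => y /=; rewrite add0r.
have := key _ (measurableC mA); rewrite setICr measure0 => /esym/eqP.
rewrite mule_eq0 => /orP[/eqP l0E|/eqP]; last by right.
by left; have := key _ mA; rewrite setIid l0E mul0e.
Qed.
End ergodicity.

Theorem theorem1 (R : realType) (d Q : nat) (hd : (0 < d)%N) (hQ : (1 < Q)%N)
    (Phi : 'Z_Q -> 'rV[R]_d) :
  let phi := step_function Phi in
  let Gamma := closed_subgroup (range phi) in
  centered phi ->
  exists SBAD : set R,
    [/\ SBAD `<=` @irrational R,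
        (@lebesgue_measure R).-negligible (~` SBAD),
        @badly_approximable R `<=` SBAD &
        forall alpha : R, SBAD alpha ->
        forall m_Gamma : {measure set (borel Gamma) -> \bar R},
          haar_measure m_Gamma ->
          let mu := (@circle_measure R \x m_Gamma)%E in
          let T := skew_product alpha (corestrict phi) in
          [/\ measure_preserving mu T, conservative mu T & ergodic mu T]].
Proof.
move=> phi Gamma cphi; have Q0 := ltnW hQ; exists (SBAD R Q); split.
- by move=> alpha; exact: SBAD_irrational.
- exact: SBAD_conegligible.
- by move=> alpha; exact: badly_approximable_SBAD.
move=> alpha Salpha m_Gamma haar mu T.
have mbox l h : (m_Gamma (box l h) < +oo)%E by exact: haar_box_finite.
have inv := haar_translation_invariant haar.
have [_ _ m0 _] := haar.
pose m := as_sigma_finite (sigma_finite_boxes mbox).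
split.
- exact: (skew_measure_preserving hQ alpha (m := m)).
- exact: (skew_conservative hQ (m := m)).
- exact: (skew_ergodic hQ (m := m)).
Qed.
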